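(* Given a finite 2-dimensional poset $\mathcal{P}$, the linear extension diameter of its downset lattice $\mathcal{D}_\mathcal{P}$ can be computed in time $O(|\mathcal{P}|^5)$.
   Context: $\mathcal{P}$ is 2-dimensional if it has a realizer $\{L_1,L_2\}$: two linear extensions whose common comparabilities are exactly those of $\mathcal{P}$. $\mathcal{D}_\mathcal{P}$ is the poset of downsets of $\mathcal{P}$ ordered by inclusion. The linear extension diameter of a finite poset is the maximum, over pairs of its linear extensions, of the number of unordered pairs of elements appearing in different orders in the two. *)

(* Defs.v *)
From HB Require Import structures.
From mathcomp Require Import all_boot all_order.

Set Implicit Arguments.
Unset Strict Implicit.
Unset Printing Implicit Defensive.

Import Order.TTheory.

Section LinearExtensions.

Context {disp : Order.disp_t} {T : finPOrderType disp}.
Implicit Types L : rel T.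

Definition linear_extension L : Prop :=
  [/\ total L, antisymmetric L, transitive L
    & forall x y : T, (x <= y)%O -> L x y].

(* [L1] and [L2] may coincide, so a chain is 2-dimensional as well. *)
Definition realizer L1 L2 : Prop :=
  [/\ linear_extension L1, linear_extension L2
    & forall x y : T, (x <= y)%O = L1 x y && L2 x y].

(* Linear extensions are reflexive relations, hence the condition [x != y]. *)
Definition reversed_pairs L1 L2 : {set {set T}} :=
  [set D : {set T} | [exists x, exists y,
     [&& x != y, D == [set x; y], L1 x y & L2 y x]]].

Definition linext_distance L1 L2 : nat := #|reversed_pairs L1 L2|.

End LinearExtensions.

Definition two_dimensional {disp} (T : finPOrderType disp) : Prop :=
  exists L1 L2 : rel T, realizer L1 L2.

Definition is_linext_diameter {disp} (T : finPOrderType disp) (k : nat) : Prop :=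
  (exists L1 L2 : rel T, [/\ linear_extension L1, linear_extension L2
                           & linext_distance L1 L2 = k]) /\
  (forall L1 L2 : rel T, linear_extension L1 -> linear_extension L2 ->
     linext_distance L1 L2 <= k).

Section DownsetLattice.

Context {disp : Order.disp_t} (P : finPOrderType disp).

Definition is_downset (A : {set P}) : bool :=
  [forall x in A, forall y, (y <= x)%O ==> (y \in A)].

Record downset := Downset { downset_val :> {set P}; _ : is_downset downset_val }.

HB.instance Definition _ := [isSub for downset_val].
HB.instance Definition _ := [Countable of downset by <:].
HB.instance Definition _ := [Finite of downset by <:].

Definition downset_le (A B : downset) : bool :=
  downset_val A \subset downset_val B.

Fact downset_le_refl : reflexive downset_le.
Proof. by move=> A; apply: subxx. Qed.

Fact downset_le_anti : antisymmetric downset_le.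
Proof. by move=> A B sAB; apply/val_inj/eqP; rewrite eqEsubset. Qed.

Fact downset_le_trans : transitive downset_le.
Proof. by move=> B A C; apply: subset_trans. Qed.

Fact downset_display : Order.disp_t. Proof. exact: Order.Disp tt tt. Qed.

HB.instance Definition _ := Order.Le_isPOrder.Build downset_display downset
  downset_le_refl downset_le_anti downset_le_trans.

End DownsetLattice.

(* Running time is measured on a random access machine under the uniform cost *)
(* criterion. The machine has registers, addressed by constants of the        *)
(* program, and a memory, addressed indirectly through registers. Registers   *)
(* and memory cells hold natural numbers. Arithmetic is limited to addition   *)
(* and truncated subtraction: with unit cost multiplication, numbers of       *)
(* exponential bit length could be created in linear time.                    *)
(* Control flow is structured; [If] and [While] test a register for being     *)
(* nonzero. Every elementary instruction and every test costs one step.       *)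

Definition reg := nat.

Inductive program : Type :=
  | Skip
  | Const of reg & nat        (* r_i := c *)
  | Add of reg & reg & reg    (* r_i := r_j + r_k *)
  | Sub of reg & reg & reg    (* r_i := max (r_j - r_k) 0 *)
  | ReadMem of reg & reg      (* r_i := mem[r_j] *)
  | WriteMem of reg & reg     (* mem[r_i] := r_j *)
  | Seq of program & program
  | If of reg & program & program
  | While of reg & program.

Record state := State { regs : reg -> nat; memory : nat -> nat }.

Definition upd (f : nat -> nat) (i v : nat) : nat -> nat :=
  fun j => if j == i then v else f j.

Definition set_reg (s : state) (i : reg) (v : nat) : state :=
  State (upd (regs s) i v) (memory s).

Definition set_mem (s : state) (a v : nat) : state :=
  State (regs s) (upd (memory s) a v).

(* [exec p s t s']: started in [s], [p] halts in [s'] after exactly [t] steps *)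
Inductive exec : program -> state -> nat -> state -> Prop :=
  | ExecSkip s : exec Skip s 1 s
  | ExecConst i c s : exec (Const i c) s 1 (set_reg s i c)
  | ExecAdd i j k s :
      exec (Add i j k) s 1 (set_reg s i (regs s j + regs s k))
  | ExecSub i j k s :
      exec (Sub i j k) s 1 (set_reg s i (regs s j - regs s k))
  | ExecReadMem i j s :
      exec (ReadMem i j) s 1 (set_reg s i (memory s (regs s j)))
  | ExecWriteMem i j s : exec (WriteMem i j) s 1 (set_mem s (regs s i) (regs s j))
  | ExecSeq p q s t s' u s'' :
      exec p s t s' -> exec q s' u s'' -> exec (Seq p q) s (t + u) s''
  | ExecIfTrue i p q s t s' :
      regs s i != 0 -> exec p s t s' -> exec (If i p q) s t.+1 s'
  | ExecIfFalse i p q s t s' :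
      regs s i = 0 -> exec q s t s' -> exec (If i p q) s t.+1 s'
  | ExecWhileDone i p s : regs s i = 0 -> exec (While i p) s 1 s
  | ExecWhileStep i p s t s' u s'' :
      regs s i != 0 -> exec p s t s' -> exec (While i p) s' u s'' ->
      exec (While i p) s (t + u).+1 s''.

Lemma exec_deterministic p s t1 s1 t2 s2 :
  exec p s t1 s1 -> exec p s t2 s2 -> t1 = t2 /\ s1 = s2.
Proof.
move=> e1; elim: e1 t2 s2 => {p s t1 s1}; intros;
  match goal with e : exec _ _ _ _ |- _ => inversion e; subst end => //;
  repeat match goal with
    | IH : (forall t s, exec ?p ?s0 t s -> _), e : exec ?p ?s0 _ _ |- _ =>
        case: (IH _ _ e) => ? ?; subst; clear e
    end => //;
  by match goal with
    z : regs ?s ?i = 0, nz : is_true (regs ?s ?i != 0) |- _ => rewrite z in nz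
  end.
Qed.

(* A poset whose elements are labelled [e 0, ..., e (n - 1)] is given to the  *)
(* machine as its order matrix: register 0 holds n, memory cell i * n + j     *)
(* holds 1 if [e i <= e j] and 0 otherwise; everything else is 0.             *)
Definition poset_input {disp} (P : finPOrderType disp) (e : 'I_#|P| -> P) : state :=
  State (fun r => if r == 0 then #|P| else 0)
        (fun a => nat_of_bool [exists i : 'I_#|P|, exists j : 'I_#|P|,
                    (a == i * #|P| + j) && (e i <= e j)%O]).

Definition output (s : state) : nat := regs s 0.

Definition bigO (f g : nat -> nat) : Prop :=
  exists C N : nat, forall n, N <= n -> f n <= C * g n.

(* Main.v *)
Require Import Defs.
From mathcomp Require Import all_boot all_order.
From mathcomp Require Import zify.

(** For downsets A and B, fix I = A n B and U = A u B. The downsets between I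
    and U whose complement in this interval is a downset as well form a Boolean
    lattice, and in it the sets A that two given linear extensions separate from
    their complements, in opposite ways, are an intersecting and co-intersecting
    family; by Kleitman's lemma it contains at most a quarter of the lattice. If
    P is 2-dimensional, its incomparability graph has a transitive orientation,
    and its union with the order of P is a linear order of P. The two
    lexicographic orders of the downsets, which compare A and B by the greatest,
    resp. the least, element of their symmetric difference, reach this bound for
    all I and U simultaneously. So the diameter is the number of pairs (A, B)
    such that the symmetric difference has its least element in A and its
    greatest one in B.

    The machine finds a transitive orientation in O(n^5) steps, as n^2 rounds
    each of which inspects all triples of elements, and counts the pairs (A, B)
    by dynamic programming in O(n^3) steps. *)

Set Implicit Arguments.
Unset Strict Implicit.
Unset Printing Implicit Defensive.

(** * A structured language compiled to the machine *)

(** Orienting each forcing class at will is not enough: in a complete graph every class is a single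
    edge, and every tournament respects forcing. The classes are therefore oriented by their least
    codes. This excludes cyclic triangles, and it gives the machine a fixed relation [lexico] to
    compute. The bound by a quarter is not attained in every fiber; a fiber with one or two members
    separates nothing. So the two sides are compared fiber by fiber: a nonempty family yields a
    member that splits the extreme elements of U minus I, and then a quarter of the fiber is
    separated. The union of the order with the orientation, and its union with the reversed
    orientation, are linear orders with intersection P. If elements are decided by decreasing rank
    in the first, only the greatest rank in the second matters for whether the next element is
    forced into a downset. Hence two numbers and a flag describe a pair of partial downsets. *)

Inductive expr : Type :=
  | EC of nat
  | EV of reg
  | EAdd of expr & expr
  | ESub of expr & expr
  | EInp of expr
  | EArr of nat & expr.

(** All loops are bounded, so the running time depends on the text and on n only. [CFor b r c] lets
    [r] run through 0, ..., b + n - 1; b = 1 serves for the n + 1 values 0, ..., n. *)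
Inductive cmd : Type :=
  | CSet of reg & expr
  | CPut of nat & expr & expr
  | CSeq of cmd & cmd
  | CIf of expr & cmd
  | CFor of nat & reg & cmd.

Record store := Store { var : nat -> nat; arr : nat -> nat -> nat }.

Definition set_var (s : store) r v := Store (upd (var s) r v) (arr s).
Definition set_arr (s : store) k i v :=
  Store (var s) (fun k' => if k' == k then upd (arr s k) i v else arr s k').

Fixpoint eval (inp : nat -> nat) (e : expr) (s : store) : nat :=
  match e with
  | EC c => c
  | EV r => var s r
  | EAdd a b => eval inp a s + eval inp b s
  | ESub a b => eval inp a s - eval inp b s
  | EInp a => inp (eval inp a s)
  | EArr k a => arr s k (eval inp a s)
  end.

Fixpoint run (inp : nat -> nat) (n : nat) (c : cmd) (s : store) : store :=
  match c with
  | CSet r e => set_var s r (eval inp e s)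
  | CPut k a e => set_arr s k (eval inp a s) (eval inp e s)
  | CSeq c1 c2 => run inp n c2 (run inp n c1 s)
  | CIf e c1 => if eval inp e s == 0 then s else run inp n c1 s
  | CFor b r c1 =>
      foldl (fun s i => run inp n c1 (set_var s r i)) s (iota 0 (b + n))
  end.

(* Registers 0 and 1 hold n and n ^ 2, registers 2 to [nvars - 1] the         *)
(* variables of the source program, the others are used for temporaries.      *)
(* Memory below n ^ 2 is the input; above it, [narrs] arrays are interleaved, *)
(* so that the address of a cell takes constant time to compute.              *)
Definition nvars := 32.
Definition narrs := 16.

Fixpoint wf_expr (e : expr) : bool :=
  match e with
  | EC _ => true
  | EV r => r < nvars
  | EAdd a b | ESub a b => wf_expr a && wf_expr b
  | EInp a => wf_expr a
  | EArr k a => (k < narrs) && wf_expr a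
  end.

Fixpoint wf_cmd (c : cmd) : bool :=
  match c with
  | CSet r e => [&& 1 < r, r < nvars & wf_expr e]
  | CPut k a e => [&& k < narrs, wf_expr a & wf_expr e]
  | CSeq c1 c2 => wf_cmd c1 && wf_cmd c2
  | CIf e c1 => wf_expr e && wf_cmd c1
  | CFor _ r c1 => [&& 1 < r, r < nvars & wf_cmd c1]
  end.

(** Four doublings multiply the index by 16 = [narrs]; register 1 contributes the base n ^ 2. *)
Definition compile_addr (k : nat) (p : program) (t : reg) : program :=
  Seq p (Seq (Add t t t) (Seq (Add t t t) (Seq (Add t t t) (Seq (Add t t t)
    (Seq (Const t.+1 k) (Seq (Add t t t.+1) (Add t t 1))))))).

(** Registers from [t] on are scratch. An input read is guarded by the test n ^ 2 - address: beyond
    n ^ 2 the memory holds the arrays, where the source program has to see zeros. *)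
Fixpoint compile_expr (e : expr) (t : reg) : program :=
  match e with
  | EC c => Const t c
  | EV r => Seq (Const t 0) (Add t r t)
  | EAdd a b => Seq (compile_expr a t) (Seq (compile_expr b t.+1) (Add t t t.+1))
  | ESub a b => Seq (compile_expr a t) (Seq (compile_expr b t.+1) (Defs.Sub t t t.+1))
  | EInp a => Seq (compile_expr a t)
                (Seq (Defs.Sub t.+1 1 t) (If t.+1 (ReadMem t t) (Const t 0)))
  | EArr k a => Seq (compile_addr k (compile_expr a t) t) (ReadMem t t)
  end.

(** A loop keeps in register [t] the number of iterations left and recomputes [r] from it; the body
    is compiled from [t.+1] on and so preserves that number. *)
Fixpoint compile (c : cmd) (t : reg) : program :=
  match c with
  | CSet r e => Seq (compile_expr e t) (Seq (Const t.+1 0) (Add r t t.+1))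
  | CPut k a e => Seq (compile_addr k (compile_expr a t) t)
                      (Seq (compile_expr e t.+1) (WriteMem t t.+1))
  | CSeq c1 c2 => Seq (compile c1 t) (compile c2 t)
  | CIf e c1 => Seq (compile_expr e t) (If t (compile c1 t) Skip)
  | CFor b r c1 =>
      Seq (Seq (Const t.+1 b) (Add t 0 t.+1))
          (While t (Seq (Seq (Const t.+1 b) (Seq (Add t.+1 0 t.+1) (Defs.Sub r t.+1 t)))
                   (Seq (compile c1 t.+1)
                        (Seq (Const t.+1 1) (Defs.Sub t t t.+1)))))
  end.

Fixpoint expr_cost (e : expr) : nat :=
  match e with
  | EC _ => 1
  | EV _ => 2
  | EAdd a b | ESub a b => expr_cost a + (expr_cost b + 1)
  | EInp a => expr_cost a + 3
  | EArr _ a => expr_cost a + 8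
  end.

Fixpoint cost (n : nat) (c : cmd) : nat :=
  match c with
  | CSet _ e => expr_cost e + 2
  | CPut _ a e => (expr_cost a + 7) + (expr_cost e + 1)
  | CSeq c1 c2 => cost n c1 + cost n c2
  | CIf e c1 => expr_cost e + (cost n c1 + 2)
  | CFor b _ c1 => 2 + ((b + n) * (cost n c1 + 6) + 1)
  end.

(** * Execution within a time bound *)

Definition reaches (p : program) (s : state) (T : nat) (Q : state -> Prop) : Prop :=
  exists t s', [/\ exec p s t s', t <= T & Q s'].

Lemma reachesW p s T T' (Q Q' : state -> Prop) :
  T <= T' -> (forall s', Q s' -> Q' s') -> reaches p s T Q -> reaches p s T' Q'.
Proof.
move=> leT QQ' [t [s' [e le_t Qs']]]; exists t, s'; split => //; last exact: QQ'.
exact: leq_trans leT.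
Qed.

Lemma reaches_seq p q s T1 T2 (Q R : state -> Prop) :
  reaches p s T1 Q -> (forall s', Q s' -> reaches q s' T2 R) ->
  reaches (Seq p q) s (T1 + T2) R.
Proof.
move=> [t [s' [e1 le1 Qs']]] /(_ _ Qs') [u [s'' [e2 le2 Rs'']]].
by exists (t + u), s''; split; [apply: ExecSeq e1 e2 | apply: leq_add | ].
Qed.

Lemma reaches_const r c s : reaches (Const r c) s 1 (eq (set_reg s r c)).
Proof. by eexists 1, _; split => //; constructor. Qed.

Lemma reaches_add i j k s :
  reaches (Add i j k) s 1 (eq (set_reg s i (regs s j + regs s k))).
Proof. by eexists 1, _; split => //; constructor. Qed.

Lemma reaches_sub i j k s :
  reaches (Defs.Sub i j k) s 1 (eq (set_reg s i (regs s j - regs s k))).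
Proof. by eexists 1, _; split => //; constructor. Qed.

Lemma reaches_read i j s :
  reaches (ReadMem i j) s 1 (eq (set_reg s i (memory s (regs s j)))).
Proof. by eexists 1, _; split => //; constructor. Qed.

Lemma reaches_write i j s :
  reaches (WriteMem i j) s 1 (eq (set_mem s (regs s i) (regs s j))).
Proof. by eexists 1, _; split => //; constructor. Qed.

Lemma reaches_skip s : reaches Skip s 1 (eq s).
Proof. by eexists 1, _; split => //; constructor. Qed.

Lemma reaches_if i p q s T (Q : state -> Prop) :
  (regs s i != 0 -> reaches p s T Q) -> (regs s i = 0 -> reaches q s T Q) ->
  reaches (If i p q) s T.+1 Q.
Proof.
move=> hp hq; case: (regs s i =P 0) => [z | /eqP nz].
  by have [t [s' [e le_t Qs']]] := hq z; exists t.+1, s'; split => //; apply: ExecIfFalse.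
by have [t [s' [e le_t Qs']]] := hp nz; exists t.+1, s'; split => //; apply: ExecIfTrue.
Qed.

(** The tested register is itself the number of iterations left, so an invariant indexed by it
    yields termination and the time bound at once. *)
Lemma reaches_while i p T (Q : nat -> state -> Prop) m s :
  (forall k s, Q k s -> regs s i = k) ->
  (forall k s, Q k.+1 s -> reaches p s T (Q k)) ->
  Q m s -> reaches (While i p) s (m * T.+1 + 1) (Q 0).
Proof.
move=> Qi step; elim: m s => [|m IH] s Qs.
  by exists 1, s; split => //; apply: ExecWhileDone; apply: Qi Qs.
have [t [s' [e1 le1 /IH [u [s'' [e2 le2 Qs'']]]]]] := step _ _ Qs.
exists (t + u).+1, s''; split => //; last by lia.
by apply: ExecWhileStep e1 e2; rewrite (Qi _ _ Qs).
Qed.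

(** * Correctness of the compiler *)

Section CompileCorrect.

Variables (inp : nat -> nat) (n B : nat).
Hypothesis inp_out : forall a, B <= a -> inp a = 0.

Record sim (s : store) (l : state) : Prop := Sim {
  sim_size : regs l 0 = n;
  sim_base : regs l 1 = B;
  sim_var : forall r, r < nvars -> regs l r = var s r;
  sim_inp : forall a, a < B -> memory l a = inp a;
  sim_arr : forall k i, k < narrs -> memory l (B + (16 * i + k)) = arr s k i }.

Definition same (t : reg) (l l' : state) : Prop :=
  (forall r, r < t -> regs l' r = regs l r) /\ memory l' = memory l.

Lemma sim_same s t l l' : nvars <= t -> sim s l -> same t l l' -> sim s l'.
Proof.
move=> le_t [s0 s1 sv si sa] [sr sm]; rewrite /nvars in le_t *.
have lt_t r : r < 32 -> r < t by move=> ?; apply: leq_trans le_t.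
by split; rewrite ?sm ?sr ?lt_t // => r ltr; rewrite sr ?lt_t // sv.
Qed.

Lemma same_refl t l : same t l l.
Proof. by []. Qed.
Local Hint Resolve same_refl : core.

Lemma same_set t l l' r v : same t l l' -> t <= r -> same t l (set_reg l' r v).
Proof.
move=> [sr sm] le; split=> //= q lt; rewrite -sr // /upd.
by case: eqP => // e; move: lt; rewrite e ltnNge le.
Qed.

Lemma same_trans t t' l1 l2 l3 :
  t <= t' -> same t l1 l2 -> same t' l2 l3 -> same t l1 l3.
Proof.
move=> le [r12 m12] [r23 m23]; split; last by rewrite m23.
by move=> r lt; rewrite r23 ?r12 // (leq_trans lt).
Qed.

Definition yields t l v l' := same t l l' /\ regs l' t = v.

Lemma upd_eq f i v : upd f i v i = v.
Proof. by rewrite /upd eqxx. Qed.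

Lemma upd_neq f i v j : j != i -> upd f i v j = f j.
Proof. by rewrite /upd => /negPf->. Qed.

Lemma upd_S f i v : upd f i v i.+1 = f i.+1.
Proof. by rewrite upd_neq // neq_ltn ltnSn orbT. Qed.

Lemma upd_SS f i v : upd f i.+1 v i = f i.
Proof. by rewrite upd_neq // neq_ltn ltnSn. Qed.

Lemma upd_base f i v j : j < nvars -> nvars <= i -> upd f i v j = f j.
Proof. by move=> ? ?; rewrite upd_neq // neq_ltn (@leq_trans nvars). Qed.

Lemma compile_addr_ok k p v T t l :
  nvars <= t -> reaches p l T (yields t l v) -> regs l 1 = B ->
  reaches (compile_addr k p t) l (T + 7) (yields t l (B + (16 * v + k))).
Proof.
move=> le_t pl l1; rewrite -[7]/(1 + (1 + (1 + (1 + (1 + (1 + 1)))))).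
apply: reaches_seq pl _ => l' [[sr sm] <-].
do 4!(apply: reaches_seq; [exact: reaches_add | move=> _ <-]).
apply: reaches_seq; [exact: reaches_const | move=> _ <-].
apply: reaches_seq; [exact: reaches_add | move=> _ <-].
apply: reachesW; [exact: leqnn| | exact: reaches_add]; move=> _ <-.
have lt1t : 1 < t by rewrite /nvars in le_t; lia.
split; first split => //= r lt.
  by rewrite !upd_neq ?sr //; lia.
rewrite /= !(upd_eq, upd_S, upd_SS).
have [n1 n2] : 1 != t /\ 1 != t.+1 by lia.
by rewrite !upd_neq // (sr 1) // l1; move: (regs l' t) => x; lia.
Qed.

Lemma compile_expr_ok e t s l :
  wf_expr e -> nvars <= t -> sim s l ->
  reaches (compile_expr e t) l (expr_cost e) (yields t l (eval inp e s)).
Proof.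
elim: e t l => [c|r|a IHa b IHb|a IHa b IHb|a IHa|k a IHa] t l /=.
- move=> _ le_t _; apply: reachesW; [exact: leqnn| | exact: reaches_const] => _ <-.
  by split; [exact: same_set | exact: upd_eq].
- move=> lt_r le_t [s0 s1 sv si sa]; apply: (reaches_seq (T1 := 1));
    [exact: reaches_const|] => _ <-.
  apply: reachesW; [exact: leqnn| | exact: reaches_add] => _ <-; split.
    by do 2!apply: same_set => //.
  by rewrite /= !upd_eq addn0 upd_base // sv.
- case/andP=> wa wb le_t sl; apply: reaches_seq (IHa _ _ wa le_t sl) _ => l1 [s1 v1].
  have sl1 := sim_same le_t sl s1.
  apply: reaches_seq (IHb t.+1 _ wb (leqW le_t) sl1) _ => l2 [[r2 m2] v2].
  apply: reachesW; [exact: leqnn| | exact: reaches_add] => _ <-; split.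
    by apply: same_set => //; apply: (same_trans (leqnSn t) s1).
  by rewrite /= upd_eq v2 r2 // v1.
- case/andP=> wa wb le_t sl; apply: reaches_seq (IHa _ _ wa le_t sl) _ => l1 [s1 v1].
  have sl1 := sim_same le_t sl s1.
  apply: reaches_seq (IHb t.+1 _ wb (leqW le_t) sl1) _ => l2 [[r2 m2] v2].
  apply: reachesW; [exact: leqnn| | exact: reaches_sub] => _ <-; split.
    by apply: same_set => //; apply: (same_trans (leqnSn t) s1).
  by rewrite /= upd_eq v2 r2 // v1.
- move=> wa le_t sl; apply: reaches_seq (IHa _ _ wa le_t sl) _ => l1 [s1 v1].
  have sl1 := sim_same le_t sl s1.
  apply: (@reaches_seq _ _ _ 1 2); [exact: reaches_sub | move=> _ <-].
  apply: reaches_if => /=; rewrite upd_eq (sim_base sl1) v1 => lt.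
    apply: reachesW; [exact: leqnn| | exact: reaches_read] => _ <-; split.
      by do 2!apply: same_set => //.
    by rewrite /= upd_eq upd_SS v1 (sim_inp sl1) //; lia.
  apply: reachesW; [exact: leqnn| | exact: reaches_const] => _ <-; split.
    by do 2!apply: same_set => //.
  by rewrite /= upd_eq inp_out //; lia.
- case/andP=> ltk wa le_t sl; rewrite -[8]/(7 + 1) addnA.
  apply: reaches_seq (compile_addr_ok k le_t (IHa _ _ wa le_t sl) (sim_base sl)) _ => l1 [s1 v1].
  apply: reachesW; [exact: leqnn| | exact: reaches_read] => _ <-; split.
    exact: same_set.
  by rewrite /= upd_eq v1 (sim_arr (sim_same le_t sl s1)).
Qed.

(** [sim] leaves registers from [nvars] on free, but enclosing loops keep their counters there; the
    second clause protects those below [t]. *)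
Definition refines t s' l l' :=
  sim s' l' /\ forall r, nvars <= r < t -> regs l' r = regs l r.

Lemma sim_set_var s l r v :
  1 < r < nvars -> sim s l -> sim (set_var s r v) (set_reg l r v).
Proof.
move=> /andP[r1 r2] [s0 s1 sv si sa]; split => //=.
- by rewrite upd_neq //; lia.
- by rewrite upd_neq //; lia.
- by move=> q lt; rewrite /upd; case: ifP => // _; apply: sv.
Qed.

Lemma sim_set_arr s l k i v :
  k < narrs -> sim s l -> sim (set_arr s k i v) (set_mem l (B + (16 * i + k)) v).
Proof.
move=> ltk [s0 s1 sv si sa]; split => //=.
- by move=> a lt; rewrite upd_neq ?si //; lia.
- move=> k' i' ltk'; rewrite /narrs in ltk ltk'; rewrite /upd sa //.
  case: (k' =P k) => [->|nk]; last by case: eqP => // ?; lia.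
  by rewrite eqn_add2l eqn_add2r eqn_mul2l.
Qed.

Lemma compile_ok c t s l :
  wf_cmd c -> nvars <= t -> sim s l ->
  reaches (compile c t) l (cost n c) (refines t (run inp n c s) l).
Proof.
elim: c t s l => [r e|k a e|c1 IH1 c2 IH2|e c1 IH1|b r c1 IH1] t s l /=.
- case/and3P=> r1 r2 we le_t sl.
  apply: reaches_seq (compile_expr_ok we le_t sl) _ => l1 [s1 v1].
  have sl1 := sim_same le_t sl s1.
  apply: (@reaches_seq _ _ _ 1 1); [exact: reaches_const | move=> _ <-].
  apply: reachesW; [exact: leqnn| | exact: reaches_add] => _ <-; split.
    rewrite /= upd_SS upd_eq addn0 v1; apply: sim_set_var; first by rewrite r1.
    by apply: sim_same le_t sl1 _; apply: same_set.
  move=> q /andP[le_q lt_q]; rewrite /= !upd_neq; [by case: s1 => ->| lia|].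
  by rewrite neq_ltn (leq_trans r2 le_q) orbT.
- case/and3P=> ltk wa we le_t sl.
  apply: reaches_seq (compile_addr_ok k le_t (compile_expr_ok wa le_t sl) (sim_base sl)) _.
  move=> l1 [s1 v1]; have sl1 := sim_same le_t sl s1.
  apply: reaches_seq (compile_expr_ok we (leqW le_t) sl1) _ => l2 [s2 v2].
  apply: reachesW; [exact: leqnn| | exact: reaches_write] => _ <-; split.
    have -> : regs l2 t = regs l1 t by case: s2 => ->.
    by rewrite v1 v2; apply: sim_set_arr => //; apply: sim_same (leqW le_t) sl1 s2.
  move=> q /andP[le_q lt_q] /=.
  by case: s2 => -> //; [case: s1 => -> | apply: leqW].
- case/andP=> w1 w2 le_t sl; apply: reaches_seq (IH1 _ _ _ w1 le_t sl) _ => l1 [sl1 r1].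
  apply: reachesW (IH2 _ _ _ w2 le_t sl1) => // l2 [sl2 r2]; split => // q lt.
  by rewrite r2 ?r1.
- case/andP=> we w1 le_t sl.
  apply: reaches_seq (compile_expr_ok we le_t sl) _ => l1 [s1 v1].
  have sl1 := sim_same le_t sl s1; rewrite addn2; apply: reaches_if; rewrite v1.
    move=> /negPf->; apply: reachesW (IH1 _ _ _ w1 le_t sl1) => // l2 [sl2 r2].
    by split => // q lt; rewrite r2 //; case: s1 => ->; case/andP: lt.
  move=> /eqP->; apply: reachesW; [| | exact: reaches_skip] => // _ <-.
  by split => // q /andP[_ lt]; case: s1 => ->.
- case/and3P=> r1 r2 w1 le_t sl; rewrite /nvars in le_t r2.
  (* [it k] is the store after k iterations, while [Q k] describes the machine with k iterations
     left. *)
  pose it k := foldl (fun s i => run inp n c1 (set_var s r i)) s (iota 0 k).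
  pose Q k l' := [/\ regs l' t = k, k <= b + n, sim (it (b + n - k)) l'
                 & forall q, nvars <= q < t -> regs l' q = regs l q].
  apply: (@reaches_seq _ _ _ 2 _ (Q (b + n))).
    apply: (@reaches_seq _ _ _ 1 1); [exact: reaches_const | move=> _ <-].
    apply: reachesW; [exact: leqnn| | exact: reaches_add] => _ <-; split => //=.
    - by rewrite !upd_eq upd_base ?(sim_size sl) 1?addnC // leqW.
    - rewrite subnn /it /=; apply: sim_same sl _; first exact: le_t.
      by do 2!apply: same_set => //.
    - by move=> q /andP[le_q lt_q]; rewrite !upd_neq //; lia.
  move=> l0 Q0; apply: (@reachesW _ _ ((b + n) * (1 + (1 + 1) + (cost n c1 + (1 + 1))).+1 + 1)
    _ (Q 0)).
  - by rewrite leq_add2r leq_mul2l; apply/orP; right; lia.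
  - move=> l' [_ _ sl' rl']; split => //; by rewrite subn0 in sl'.
  apply: reaches_while Q0; first by move=> k l' [].
  move=> k l1 [tk lek sl1 rl1].
  apply: (@reaches_seq _ _ _ _ _ (fun l' => refines t.+1 (set_var (it (b + n - k.+1)) r (b + n
    - k.+1)) l1 l')).
    rewrite -[1 + (1 + 1)]/(1 + (1 + 1)).
    apply: reaches_seq; [exact: reaches_const | move=> _ <-].
    apply: reaches_seq; [exact: reaches_add | move=> _ <-].
    apply: reachesW; [exact: leqnn| | exact: reaches_sub] => _ <-; split.
      rewrite /= !(upd_eq, upd_SS) upd_base ?(sim_size sl1) //; last exact: leqW.
      rewrite tk (addnC n b); apply: sim_set_var; first by rewrite r1.
      apply: sim_same sl1 _; first exact: le_t.
      by do 2!apply: same_set => //.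
    by move=> q /andP[le_q lt_q]; rewrite /= !upd_neq //; rewrite /nvars in le_q; lia.
  move=> l2 [sl2 rl2].
  apply: reaches_seq (IH1 t.+1 _ _ w1 (leqW le_t) sl2) _ => l3 [sl3 rl3].
  apply: reaches_seq; [exact: reaches_const | move=> _ <-].
  apply: reachesW; [exact: leqnn| | exact: reaches_sub] => _ <-; split.
  - by rewrite /= upd_eq upd_SS upd_eq rl3 ?rl2 ?tk ?subn1 //; rewrite /nvars; lia.
  - by lia.
  - have -> : b + n - k = (b + n - k.+1).+1 by lia.
    rewrite /it -addn1 iotaD foldl_cat /= add0n.
    apply: sim_same sl3 _; first exact: le_t.
    by do 2!apply: same_set => //.
  - move=> q /andP[le_q lt_q]; rewrite /= !upd_neq; [|lia|lia].
    by rewrite rl3 ?rl2 ?rl1 //; lia.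
Qed.

End CompileCorrect.

(** * Running time of compiled programs *)

Fixpoint depth (c : cmd) : nat :=
  match c with
  | CSet _ _ | CPut _ _ _ => 0
  | CSeq c1 c2 => maxn (depth c1) (depth c2)
  | CIf _ c1 => depth c1
  | CFor _ _ c1 => (depth c1).+1
  end.

(** Powers of n + 1 are positive even for n = 0, so the factor [K] can absorb additive constants. *)
Lemma cost_bound c : exists K, forall n, cost n c <= K * n.+1 ^ depth c.
Proof.
have E k n : 0 < n.+1 ^ k by rewrite expn_gt0.
elim: c => [r e|k a e|c1 [K1 IH1] c2 [K2 IH2]|e c1 [K IH]|b r c1 [K IH]] /=.
- by exists (expr_cost e + 2) => n; rewrite muln1.
- by exists (expr_cost a + 7 + (expr_cost e + 1)) => n; rewrite muln1.
- exists (K1 + K2) => n; rewrite mulnDl leq_add //.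
    by apply: leq_trans (IH1 n) _; rewrite leq_mul2l leq_pexp2l ?orbT ?leq_maxl.
  by apply: leq_trans (IH2 n) _; rewrite leq_mul2l leq_pexp2l ?orbT ?leq_maxr.
- exists (expr_cost e + 2 + K) => n; have := IH n; have := E (depth c1) n; nia.
- exists (3 + b.+1 * (K + 6)) => n; rewrite expnS.
  have bn : b + n <= b.+1 * n.+1 by nia.
  have := IH n; have := E (depth c1) n; set x := n.+1 ^ _ => x0 cx.
  have h1 : cost n c1 + 6 <= (K + 6) * x by nia.
  have := leq_mul bn h1; nia.
Qed.

Definition prelude : program :=
  Seq (Add 2 0 1) (While 2 (Seq (Add 1 1 0) (Seq (Const 3 1) (Defs.Sub 2 2 3)))).

Lemma prelude_ok n m :
  reaches prelude (State (fun r => if r == 0 then n else 0) m) (1 + (n * 4 + 1))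
    (fun l => [/\ regs l 0 = n, regs l 1 = n * n & memory l = m]).
Proof.
pose Q k l := [/\ regs l 2 = k, k <= n, regs l 0 = n, regs l 1 = (n - k) * n & memory l = m].
apply: reaches_seq; first exact: reaches_add.
move=> _ <-; apply: (@reachesW _ _ (n * 4 + 1) _ (Q 0)) => //.
  by move=> l [_ _ l0 l1 lm]; rewrite l0 l1 subn0.
apply: reaches_while; first by move=> k l [].
- move=> k l [l2 lek l0 l1 lm]; rewrite -[3]/(1 + (1 + 1)).
  apply: reaches_seq; [exact: reaches_add | move=> _ <-].
  apply: reaches_seq; [exact: reaches_const | move=> _ <-].
  apply: reachesW; [exact: leqnn| | exact: reaches_sub] => _ <-.
  split; rewrite /= /upd /= ?l2 ?l0 ?l1 //; first by rewrite subn1.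
    exact: ltnW.
  by rewrite -mulSnr subnSK.
- by split => //=; rewrite ?upd_eq ?addn0 // /upd /= subnn.
Qed.

(** Of the initial variables [v] only [v 0] is specified, since [prelude] leaves values in registers
    2 and 3; source programs initialize what they use. *)
Lemma program_of c e d :
  wf_cmd c -> wf_expr e -> depth c <= d -> 0 < d ->
  exists (p : program) (T : nat -> nat), bigO T (fun n => n ^ d) /\
    forall n inp, (forall a, n * n <= a -> inp a = 0) ->
    exists v t s, [/\ exec p (State (fun r => if r == 0 then n else 0) inp) t s,
      t <= T n, v 0 = n
      & output s = eval inp e (run inp n c (Store v (fun _ _ => 0)))].
Proof.
move=> wc we le_d d0; have [K costK] := cost_bound c.
exists (Seq prelude (Seq (compile c nvars) (Seq (compile_expr e nvars)
         (Seq (Const nvars.+1 0) (Add 0 nvars nvars.+1))))).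
exists (fun n => 1 + (n * 4 + 1) + (K * n.+1 ^ d + (expr_cost e + (1 + 1)))); split.
  (* For n >= 1 we have n + 1 <= 2 n, whence the factor 2 ^ d and the threshold 1. *)
  exists (6 + K * 2 ^ d + expr_cost e + 2), 1 => n n1.
  have h1 : n.+1 ^ d <= 2 ^ d * n ^ d by rewrite -expnMn leq_exp2r //; lia.
  have h2 : n <= n ^ d by rewrite -{1}(expn1 n) leq_pexp2l.
  by move: h1 h2; set x := n.+1 ^ d; set y := n ^ d; set z := 2 ^ d; nia.
move=> n inp inp_out.
pose v0 : nat -> nat := fun r => if r == 0 then n else 0.
have [t1 [l1 [e1 le1 [l10 l11 l1m]]]] := prelude_ok n inp.
pose s1 := Store (regs l1) (fun _ _ => 0).
have sl1 : sim inp n (n * n) s1 l1.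
  by split => //= [a _|k i _]; rewrite l1m // inp_out // leq_addr.
have [t2 [l2 [e2 le2 [sl2 _]]]] := compile_ok inp_out wc (leqnn nvars) sl1.
have [t3 [l3 [e3 le3 [_ v3]]]] := compile_expr_ok inp_out we (leqnn nvars) sl2.
have [t4 [l4 [e4 le4 v4]]] : reaches (Seq (Const nvars.+1 0) (Add 0 nvars nvars.+1)) l3 (1 + 1)
    (fun l4 => regs l4 0 = regs l3 nvars).
  apply: reaches_seq; [exact: reaches_const | move=> _ <-].
  apply: reachesW; [exact: leqnn| | exact: reaches_add] => _ <-.
  by rewrite /= upd_eq upd_SS upd_eq addn0.
exists (regs l1), (t1 + (t2 + (t3 + t4))), l4; split => //.
- by apply: ExecSeq e1 (ExecSeq e2 (ExecSeq e3 e4)).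
- rewrite !leq_add // (leq_trans le2) // (leq_trans (costK n)) //.
  by rewrite leq_mul2l leq_pexp2l ?orbT.
- by rewrite /output v4 v3.
Qed.

(** * Frames and loop invariants *)

Fixpoint assigns (c : cmd) (r : reg) : bool :=
  match c with
  | CSet r' _ => r == r'
  | CPut _ _ _ => false
  | CSeq c1 c2 => assigns c1 r || assigns c2 r
  | CIf _ c1 => assigns c1 r
  | CFor _ r' c1 => (r == r') || assigns c1 r
  end.

Fixpoint writes (c : cmd) (k : nat) : bool :=
  match c with
  | CSet _ _ => false
  | CPut k' _ _ => k == k'
  | CSeq c1 c2 => writes c1 k || writes c2 k
  | CIf _ c1 => writes c1 k
  | CFor _ _ c1 => writes c1 k
  end.

(** The criterion is syntactic: on a concrete program [assigns] and [writes] evaluate, so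
    preservation of what is untouched is settled by computation. *)
Definition frame (c : cmd) (s s' : store) : Prop :=
  (forall r, ~~ assigns c r -> var s' r = var s r) /\
  (forall k, ~~ writes c k -> arr s' k = arr s k).

Section Semantics.

Variables (inp : nat -> nat) (n : nat).
Notation run := (run inp n).
Notation eval := (eval inp).

Lemma foldl_iota_ind (I : nat -> store -> Prop) f s m :
  I 0 s -> (forall i s, i < m -> I i s -> I i.+1 (f s i)) -> I m (foldl f s (iota 0 m)).
Proof.
move=> I0 step; suff: forall k, k <= m -> I k (foldl f s (iota 0 k)) by apply.
elim=> [//|k IH] lt; rewrite -addn1 iotaD foldl_cat /= add0n addn1.
by apply: step => //; apply: IH; apply: ltnW.
Qed.

Lemma run_frame c s : frame c s (run c s).
Proof.
elim: c s => [r e|k a e|c1 IH1 c2 IH2|e c1 IH1|b r c1 IH1] s /=; split => // q.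
- by move=> /= nq; apply: upd_neq.
- by move=> /= /negPf->.
- by rewrite /= negb_or => /andP[n1 n2]; rewrite (IH2 _).1 // (IH1 _).1.
- by rewrite /= negb_or => /andP[n1 n2]; rewrite (IH2 _).2 // (IH1 _).2.
- by move=> /= nq; case: ifP => // _; rewrite (IH1 _).1.
- by move=> /= nq; case: ifP => // _; rewrite (IH1 _).2.
- rewrite /= negb_or => /andP[n1 n2].
  apply: (foldl_iota_ind (I := fun _ s' => var s' q = var s q)) => // i s' _ <-.
  by rewrite (IH1 _).1 //= upd_neq.
- move=> /= nq.
  apply: (foldl_iota_ind (I := fun _ s' => arr s' q = arr s q)) => // i s' _ <-.
  by rewrite (IH1 _).2.
Qed.

(** The step may assume the frame of the whole loop relative to its start, so [I] has to mention
    only what the loop changes. *)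
Lemma for_ind (I : nat -> store -> Prop) b r c s :
  I 0 s ->
  (forall i s', i < b + n -> frame (CFor b r c) s s' -> I i s' ->
     I i.+1 (run c (set_var s' r i))) ->
  I (b + n) (run (CFor b r c) s).
Proof.
move=> I0 step.
suff [] : frame (CFor b r c) s (run (CFor b r c) s) /\ I (b + n) (run (CFor b r c) s) by [].
apply: (foldl_iota_ind (I := fun i s' => frame (CFor b r c) s s' /\ I i s')) => //.
move=> i s' lt [[fv fa] Ii]; split; last by apply: step.
have [gv ga] := run_frame c (set_var s' r i); split=> q /= nq.
  move: (nq); rewrite negb_or => /andP[n1 n2].
  by rewrite gv //= upd_neq // fv.
by rewrite ga //= fa.
Qed.

(* A loop whose body may raise the flag [f] but never lowers it *)
Lemma for_flag f (I : store -> Prop) (Q : nat -> Prop) b r c s :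
  r != f -> I s ->
  (forall i s', i < b + n -> frame (CFor b r c) s s' -> I s' ->
     (var s' f = 0 -> var s f = 0 /\ forall i', i' < i -> Q i') ->
     I (run c (set_var s' r i)) /\
     (var (run c (set_var s' r i)) f = 0 -> var s' f = 0 /\ Q i)) ->
  I (run (CFor b r c) s) /\
  (var (run (CFor b r c) s) f = 0 -> var s f = 0 /\ forall i, i < b + n -> Q i).
Proof.
move=> rf Is step.
apply: (for_ind (I := fun i s' => I s' /\
  (var s' f = 0 -> var s f = 0 /\ forall i', i' < i -> Q i'))) => // i s' lt fr [Is' h].
have [I' h'] := step i s' lt fr Is' h; split => // /h'[s'f Qi].
have [sf Qlt] := h s'f; split => // i'; rewrite ltnS leq_eqVlt => /orP[/eqP->//|].
exact: Qlt.
Qed.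

Lemma runE :
  ((forall r e s, run (CSet r e) s = set_var s r (eval e s)) *
   (forall k a e s, run (CPut k a e) s = set_arr s k (eval a s) (eval e s)) *
   (forall c1 c2 s, run (CSeq c1 c2) s = run c2 (run c1 s)) *
   (forall e c s, run (CIf e c) s = if eval e s == 0 then s else run c s))%type.
Proof. by []. Qed.

End Semantics.

Arguments run : simpl never.

(** * Transitive orientations *)

Section TransitiveOrientation.

Variables (n : nat) (G : rel 'I_n).
Hypotheses (G_sym : symmetric G) (G_irr : irreflexive G).
Variable R : rel 'I_n.
Hypotheses (R_trans : transitive R) (RG : forall x y, G x y = R x y || R y x).

Implicit Types (a b c v x y : 'I_n) (p q : 'I_n * 'I_n).

(* Gallai's forcing relation: two edges with a common end and whose other     *)
(* ends are not adjacent are oriented both from or both towards the common end *)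
Definition forces p q : bool :=
  [&& G p.1 p.2, G q.1 q.2 &
    (p.1 == q.1) && ~~ G p.2 q.2 || (p.2 == q.2) && ~~ G p.1 q.1].

Definition swap p := (p.2, p.1).
Definition code p := p.1 * n + p.2.

(* Of the two orientations of a forcing class, [lexico] has the one which     *)
(* contains the edge, oriented either way, of the least code.                 *)
Definition lexico x y : bool :=
  G x y && [exists p, connect forces (x, y) p &&
    [forall q, connect forces (x, y) q ==> (code p <= minn (code q) (code (swap q)))]].

Lemma forces_sym : symmetric forces.
Proof.
move=> p q; rewrite /forces (eq_sym p.1) (eq_sym p.2) (G_sym p.2 q.2) (G_sym p.1 q.1).
by rewrite andbCA.
Qed.

Lemma connect_forces_sym p q : connect forces p q = connect forces q p.
Proof. exact: (sym_connect_sym forces_sym). Qed.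

Lemma connect_ind (Q : 'I_n * 'I_n -> Prop) p q :
  (forall p q, forces p q -> Q p -> Q q) -> connect forces p q -> Q p -> Q q.
Proof.
move=> step /connectP[s ps ->] {q}; elim: s p ps => //= q s IH p /andP[pq qs] Qp.
by apply: IH qs _; apply: step pq Qp.
Qed.

Lemma forces_swap p q : forces p q -> forces (swap p) (swap q).
Proof. by rewrite /forces /= (G_sym p.2 p.1) (G_sym q.2 q.1) orbC. Qed.

Lemma connect_swap p q : connect forces p q -> connect forces (swap p) (swap q).
Proof.
move=> pq; apply: (connect_ind (Q := fun q => connect forces (swap p) (swap q)) _ pq (connect0
  _ _)).
by move=> p1 q1 pq1 h; apply: connect_trans h (connect1 (forces_swap pq1)).
Qed.

Lemma connect_edge p q : connect forces p q -> G p.1 p.2 -> G q.1 q.2.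
Proof.
move=> pq; apply: (connect_ind (Q := fun p => G p.1 p.2) _ pq).
by move=> p1 q1 /and3P[].
Qed.

Lemma R_irr x : R x x = false.
Proof. by have := G_irr x; rewrite RG orbb. Qed.

(** Otherwise the two edges would compose through their common end, and transitivity would make the
    other ends adjacent. *)
Lemma R_forces p q : forces p q -> R p.1 p.2 -> R q.1 q.2.
Proof.
case: p q => [b c] [b' c'] /and3P[/= _]; rewrite RG => /orP[//|Rcb] + Rbc.
case/orP => /andP[/eqP e]; subst; rewrite RG negb_or => /andP[h1 h2].
  by rewrite (R_trans Rcb Rbc) in h2.
by rewrite (R_trans Rbc Rcb) in h1.
Qed.

(** The given orientation [R] enters the later arguments through this fact: it orients a class
    consistently, so no class contains an edge in both directions. *)
Lemma connect_swapN x y : G x y -> ~~ connect forces (x, y) (y, x).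
Proof.
move=> Gxy; apply/negP => xy; have Q := connect_ind (Q := fun p => R p.1 p.2) R_forces.
have : R x y && R y x.
  move: Gxy; rewrite RG => /orP[Rxy|Ryx]; first by rewrite Rxy (Q _ _ xy).
  by rewrite connect_forces_sym in xy; rewrite Ryx (Q _ _ xy).
by case/andP => /R_trans h /h; rewrite R_irr.
Qed.

Lemma lexico_edge x y : lexico x y -> G x y.
Proof. by case/andP. Qed.

Lemma lexico_connect p q : connect forces p q -> lexico p.1 p.2 -> lexico q.1 q.2.
Proof.
case: p q => [x y] [x' y'] /= pq /andP[Gxy /existsP[m /andP[xym /forallP mP]]].
rewrite /lexico (connect_edge pq Gxy); apply/existsP; exists m.
have qp := pq; rewrite connect_forces_sym in qp.
rewrite (connect_trans qp xym); apply/forallP => q; apply/implyP => x'q.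
by have /implyP := mP q; apply; apply: connect_trans pq x'q.
Qed.

Lemma lexico_total x y : G x y -> lexico x y || lexico y x.
Proof.
move=> Gxy; pose r q := minn (code q) (code (swap q)).
have [m xym mP] := @arg_minnP _ (x, y) (connect forces (x, y)) r (connect0 _ _).
rewrite /lexico (G_sym y x) Gxy; apply/orP.
have [le|lt] := leqP (code m) (code (swap m)).
  left; apply/existsP; exists m; rewrite xym; apply/forallP => q; apply/implyP => /mP.
  by rewrite /r (minn_idPl le).
right; apply/existsP; exists (swap m); rewrite (connect_swap xym).
apply/forallP => q; apply/implyP => /connect_swap/mP.
by rewrite /r (minn_idPr (ltnW lt)) minnC; case: q.
Qed.

Lemma code_inj p q : code p = code q -> p = q.
Proof.
case: p q => [x y] [x' y'] /= e; have n0 : 0 < n by apply: leq_ltn_trans (ltn_ord x).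
have ex : x = x' :> nat.
  by have := congr1 (divn^~ n) e; rewrite /code /= !divnMDl // !divn_small ?addn0.
have ey : y = y' :> nat by move: e; rewrite /code /= ex => /addnI.
by congr (_, _); apply: val_inj.
Qed.

(** Both witnesses minimize [code] over a class and its reverse together, so they coincide; a common
    edge would merge the class with its reverse. *)
Lemma lexico_asym x y : lexico x y -> ~~ lexico y x.
Proof.
move=> /andP[Gxy /existsP[p /andP[xyp /forallP pP]]]; apply/negP.
move=> /andP[_ /existsP[q /andP[yxq /forallP qP]]].
have pq : p = q.
  apply: code_inj; apply: anti_leq; apply/andP; split.
    have /implyP/(_ (connect_swap yxq)) := pP (swap q).
    by rewrite leq_min => /andP[_]; case: q {yxq qP}.
  have /implyP/(_ (connect_swap xyp)) := qP (swap p).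
  by rewrite leq_min => /andP[_]; case: p {xyp pP}.
have := connect_swapN Gxy; rewrite (connect_trans xyp) // pq.
by rewrite connect_forces_sym.
Qed.

(** The triangle lemma for forcing classes: the edge opposite to [a] moves through its class while
    the edges at [a] stay in theirs. If a moved end were not adjacent to [a], the moved edge would
    force an edge at [a], and the class of (b, c) would contain (b, a) or (a, c), against
    asymmetry. *)
Lemma cyclic_triangle a b c p :
  lexico a b -> lexico b c -> lexico c a -> connect forces (b, c) p ->
  connect forces (a, b) (a, p.1) /\ connect forces (c, a) (p.2, a).
Proof.
move=> Fab Fbc Fca bcp.
suff [_ []] : connect forces (b, c) p /\
  connect forces (a, b) (a, p.1) /\ connect forces (c, a) (p.2, a) by [].
apply: (connect_ind (Q := fun p => connect forces (b, c) p /\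
  connect forces (a, b) (a, p.1) /\ connect forces (c, a) (p.2, a)) _ bcp) => //.
move=> {bcp} {}p q pq [bcp [abp cap]]; have bcq := connect_trans bcp (connect1 pq).
have Gap := connect_edge abp (lexico_edge Fab).
have Gpa := connect_edge cap (lexico_edge Fca).
have [Gp Gq] : G p.1 p.2 /\ G q.1 q.2 by case/and3P: pq.
have Fba : ~ connect forces (b, c) (b, a).
  by move=> h; have := lexico_connect h Fbc; apply/negP/lexico_asym.
have Fac : ~ connect forces (b, c) (a, c).
  by move=> h; have := lexico_connect h Fbc; apply/negP/lexico_asym.
split => //; case/and3P: pq => _ _ /orP[/andP[/eqP e nG]|/andP[/eqP e nG]].
- rewrite -e; split => //; apply: connect_trans cap (connect1 _).
  rewrite /forces /= Gpa eqxx nG orbT andbT; apply: contraT => nGqa; case: Fba.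
  apply: connect_trans bcq _; rewrite connect_forces_sym.
  apply: connect_trans (connect_swap abp) (connect1 _).
  by rewrite /forces /= Gq G_sym Gap e eqxx G_sym nGqa.
- rewrite -e; split => //; apply: connect_trans abp (connect1 _).
  rewrite /forces /= Gap eqxx nG !andbT; apply: contraT => nGaq; case: Fac.
  apply: connect_trans bcq _; rewrite connect_forces_sym.
  apply: connect_trans (connect_swap cap) (connect1 _).
  by rewrite /forces /= Gq G_sym Gpa e eqxx nGaq orbT.
Qed.

(** [code] gives priority to the first component, and some edge of the class, possibly reversed,
    starts at [v]. Hence so does the edge of least code, which lies in the class by [lexico a b]. *)
Lemma min_source a b v : lexico a b ->
  (forall q, connect forces (a, b) q -> v <= q.1 /\ v <= q.2) ->
  (exists2 q, connect forces (a, b) q & v = q.1 \/ v = q.2) ->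
  exists w, connect forces (a, b) (v, w).
Proof.
move=> /andP[_ /existsP[[x w] /andP[abp /forallP pP]]] vmin [q abq vq].
exists w; suff -> : v = x by [].
apply/val_inj/anti_leq/andP; split; first by have [] := vmin _ abp.
have /implyP/(_ abq) := pP q; rewrite leq_min /code /= => /andP[le1 le2].
have hn : x * n + w < v.+1 * n.
  rewrite mulSnr; case: vq => ->.
    by apply: leq_ltn_trans le1 _; rewrite ltn_add2l.
  by apply: leq_ltn_trans le2 _; rewrite ltn_add2l.
have n0 : 0 < n by apply: leq_ltn_trans (ltn_ord v).
by rewrite -ltnS -(ltn_pmul2r n0); apply: leq_ltn_trans hn; apply: leq_addr.
Qed.

(** The class of (b, c) has an edge leaving [v]. The triangle lemma puts (a, v) in the class of (a,
    b), which thus has an edge leaving [v] as well. Two rotations give (v, c) in the class of (b, c)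
    and (c, v) in that of (c, a), so [lexico] would contain both. *)
Lemma no_min_triangle a b c v :
  lexico a b -> lexico b c -> lexico c a ->
  (forall q, [|| connect forces (a, b) q, connect forces (b, c) q
                | connect forces (c, a) q] -> v <= q.1 /\ v <= q.2) ->
  ~ (exists2 q, connect forces (b, c) q & v = q.1 \/ v = q.2).
Proof.
move=> Fab Fbc Fca vmin vbc.
have [|u bcv] := min_source Fbc _ vbc; first by move=> q h; apply: vmin; rewrite h orbT.
have [abv _] := cyclic_triangle Fab Fbc Fca bcv; rewrite /= in abv.
have [||w abw] := @min_source a b v Fab; [|by exists (a, v) => //; right|].
  by move=> q h; apply: vmin; rewrite h.
have [cav _] := cyclic_triangle Fca Fab Fbc abw.
have [_ bcv'] := cyclic_triangle Fca Fab Fbc abv.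
have := lexico_connect bcv' Fbc; apply/negP/lexico_asym.
exact: lexico_connect cav Fca.
Qed.

Lemma no_cyclic_triangle a b c : lexico a b -> lexico b c -> ~~ lexico c a.
Proof.
move=> Fab Fbc; apply/negP => Fca.
pose K q := [|| connect forces (a, b) q, connect forces (b, c) q | connect forces (c, a) q].
pose V v := [exists q, K q && ((v == q.1) || (v == q.2))].
have Va : V a by apply/existsP; exists (a, b); rewrite /K connect0 eqxx.
have [v /existsP[q /andP[Kq vq]] vP] := @arg_minnP _ a V (fun v : 'I_n => v : nat) Va.
have vmin p : K p -> v <= p.1 /\ v <= p.2.
  by move=> Kp; split; apply: vP; apply/existsP; exists p; rewrite Kp eqxx ?orbT.
have {}vq : v = q.1 \/ v = q.2 by case/orP: vq => /eqP; [left | right].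
case/or3P: (Kq) => Kq'.
- apply: (no_min_triangle Fca Fab Fbc (v := v)); last by exists q.
  by move=> p hp; apply: vmin; move: hp; rewrite /K; case/or3P => ->; rewrite ?orbT.
- by apply: (no_min_triangle Fab Fbc Fca (v := v)); last by exists q.
- apply: (no_min_triangle Fbc Fca Fab (v := v)); last by exists q.
  by move=> p hp; apply: vmin; move: hp; rewrite /K; case/or3P => ->; rewrite ?orbT.
Qed.

Lemma lexico_forces a b c d : forces (a, b) (c, d) -> lexico a b -> lexico c d.
Proof. by move=> f; apply: (lexico_connect (connect1 f)). Qed.

(** If [a] and [c] were not adjacent, (a, b) would force (c, b) against (b, c); if they are, the
    edge from [c] to [a] would close a cyclic triangle. *)
Lemma lexico_trans : transitive lexico.
Proof.
move=> b a c Fab Fbc; case: (boolP (G a c)) => [/lexico_total/orP[//|Fca]|nGac].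
  by have := no_cyclic_triangle Fab Fbc; rewrite Fca.
have := lexico_asym Fbc; rewrite (@lexico_forces a b c b) //.
by rewrite /forces /= (lexico_edge Fab) (G_sym c b) (lexico_edge Fbc) eqxx nGac orbT.
Qed.

(* Greedy step: once a partial orientation is closed under forcing, its       *)
(* unoriented edge of least code is the least one of an untouched class.      *)
Lemma lexico_least (O : rel 'I_n) x y :
  (forall a b, O a b -> lexico a b) ->
  (forall p q, forces p q -> O p.1 p.2 -> O q.1 q.2) ->
  G x y -> ~~ O x y -> ~~ O y x ->
  (forall a b, G a b -> ~~ O a b -> ~~ O b a -> code (x, y) <= code (a, b)) ->
  lexico x y.
Proof.
move=> OF Oclosed Gxy nxy nyx least; rewrite /lexico Gxy; apply/existsP.
exists (x, y); rewrite connect0; apply/forallP => q; apply/implyP => xyq.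
have Gq := connect_edge xyq Gxy.
have Oconn p r : connect forces p r -> O p.1 p.2 -> O r.1 r.2.
  by move=> pr; apply: (connect_ind (Q := fun p => O p.1 p.2) Oclosed pr).
have nq : ~~ O q.1 q.2.
  by apply: contra nxy; apply: (Oconn q (x, y)); rewrite connect_forces_sym.
have nsq : ~~ O q.2 q.1.
  apply: contra nyx; apply: (Oconn (swap q) (y, x)).
  by rewrite connect_forces_sym; apply: (connect_swap xyq).
by rewrite leq_min; case: q Gq nq nsq {xyq} => a b /= ? ? ?; rewrite !least // G_sym.
Qed.

End TransitiveOrientation.

(** * The program *)

(* Storage of the program. Array 0: the multiples of n + 1, which are the row *)
(* offsets of the other arrays (n * i = (n + 1) * i - i is one of the input); *)
(* array 1: the orientation; array 2: the height of the element of a given    *)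
(* position; arrays 3, 4, 5: the table of the dynamic program for the flags   *)
(* 0, 1, 2, in layers of (n + 1) ^ 2 cells. Variable 2: the size of a layer;  *)
(* 3, 4, 6, 7, 8: loop counters; 5: set when a round has oriented a pair;     *)
(* 11: the offset of the current layer; 13: the height being inserted.        *)
Definition le_expr (x y : reg) : expr := EInp (EAdd (ESub (EArr 0 (EV x)) (EV x)) (EV y)).
Definition inc_expr (x y : reg) : expr := ESub (EC 1) (EAdd (le_expr x y) (le_expr y x)).
Definition cell (x y : reg) : expr := EAdd (EArr 0 (EV x)) (EV y).
Definition oriented_expr (x y : reg) : expr := EArr 1 (cell x y).

Definition rows_cmd : cmd :=
  CSeq (CSet 2 (EC 0))
  (CFor 1 3 (CSeq (CPut 0 (EV 3) (EV 2)) (CSet 2 (EAdd (EV 2) (EAdd (EV 0) (EC 1)))))).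

Definition orient_if (e : expr) (x y : reg) : cmd :=
  CIf e (CSeq (CPut 1 (cell x y) (EC 1)) (CSet 5 (EC 1))).

(* On Boolean values, x - (y + z + ...) is nonzero iff x holds and y, z, ...  *)
(* do not.                                                                    *)
Definition force_cmd : cmd :=
  CSeq (orient_if (ESub (inc_expr 6 8) (EAdd (inc_expr 7 8)
          (EAdd (ESub (EC 1) (oriented_expr 6 7)) (oriented_expr 6 8)))) 6 8)
       (orient_if (ESub (inc_expr 8 6) (EAdd (inc_expr 8 7)
          (EAdd (ESub (EC 1) (oriented_expr 7 6)) (oriented_expr 8 6)))) 8 6).

(** The flag, variable 5, is among the subtracted terms: a pair is picked only if nothing was forced
    or picked before in this round, so the orientation is closed and the pair is the first
    unoriented one in the order of codes. *)
Definition pick_cmd : cmd :=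
  orient_if (ESub (inc_expr 6 7)
    (EAdd (oriented_expr 6 7) (EAdd (oriented_expr 7 6) (EV 5)))) 6 7.

Definition round_cmd : cmd :=
  CSeq (CSet 5 (EC 0))
  (CSeq (CFor 0 6 (CFor 0 7 (CFor 0 8 force_cmd)))
        (CFor 0 6 (CFor 0 7 pick_cmd))).

(** A round that starts with an incomplete orientation orients at least one new ordered pair, and
    there are n ^ 2 ordered pairs. *)
Definition orientation_cmd : cmd := CFor 0 3 (CFor 0 4 round_cmd).

(** * Computing the transitive orientation *)

Section Algorithm.

Variables (n : nat) (inp : nat -> nat) (le : rel 'I_n).
Hypothesis inpE : forall i j : 'I_n, inp (i * n + j) = le i j.
Hypothesis le_refl : reflexive le.

Notation run := (run inp n).
Notation eval := (eval inp).

Definition inc (i j : 'I_n) : bool := ~~ le i j && ~~ le j i.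

Variable R : rel 'I_n.
Hypotheses (R_trans : transitive R) (R_inc : forall x y, inc x y = R x y || R y x).

Notation F := (lexico inc).

Lemma inc_sym : symmetric inc.
Proof. by move=> i j; rewrite /inc andbC. Qed.

Lemma inc_irr : irreflexive inc.
Proof. by move=> i; rewrite /inc le_refl. Qed.

Definition rows s := forall i, i <= n -> arr s 0 i = i * n.+1.

Lemma rows_ok s : var s 0 = n -> let s' := run rows_cmd s in
  [/\ rows s', var s' 2 = n.+1 * n.+1 & var s' 0 = n].
Proof.
move=> s0; rewrite /rows_cmd !runE; set s1 := set_var _ _ _.
pose I i s := [/\ var s 2 = i * n.+1, var s 0 = n
  & forall i', i' < i -> arr s 0 i' = i' * n.+1].
suff [h2 h0 ha] : I (1 + n) (run (CFor 1 3 (CSeq (CPut 0 (EV 3) (EV 2))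
    (CSet 2 (EAdd (EV 2) (EAdd (EV 0) (EC 1)))))) s1).
  by split=> // i le_i; apply: ha.
apply: for_ind => // i s' lt _ [h2 h0 ha]; rewrite !runE /I /= /upd /= h2 h0; split => //.
  by rewrite mulSn addnC addn1.
move=> i'; rewrite ltnS leq_eqVlt => /orP[/eqP->|lt']; first by rewrite eqxx.
by rewrite ltn_eqF // ha.
Qed.

Lemma cell_inj (i j i' j' : nat) : j <= n -> j' <= n ->
  (i * n.+1 + j == i' * n.+1 + j') = (i == i') && (j == j').
Proof.
move=> le_j le_j'; apply/eqP/andP => [e|[/eqP-> /eqP->] //].
have ei : i = i'.
  by have := congr1 (divn^~ n.+1) e; rewrite /= !divnMDl // !divn_small ?addn0.
by split; apply/eqP => //; move: e; rewrite ei => /addnI.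
Qed.

Lemma le_exprE s x y (i j : 'I_n) : rows s -> var s x = i -> var s y = j ->
  eval (le_expr x y) s = le i j.
Proof.
move=> rs xi yj; rewrite /= xi yj rs; last exact: ltnW.
by rewrite mulnS addKn inpE.
Qed.

Lemma inc_exprE s x y (i j : 'I_n) : rows s -> var s x = i -> var s y = j ->
  eval (inc_expr x y) s = inc i j.
Proof.
move=> rs xi yj; rewrite /inc_expr /inc.
have := le_exprE rs xi yj; have := le_exprE rs yj xi.
rewrite -[eval (ESub _ _) s]/(1 - (eval (le_expr x y) s + eval (le_expr y x) s)) => -> ->.
by case: (le i j) (le j i) => [] [].
Qed.

Definition oriented s : rel 'I_n := fun i j => arr s 1 (i * n.+1 + j) == 1.
Definition boolean s := forall i j : 'I_n, arr s 1 (i * n.+1 + j) = oriented s i j.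

Lemma oriented_exprE s x y (i j : 'I_n) :
  rows s -> boolean s -> var s x = i -> var s y = j ->
  eval (oriented_expr x y) s = oriented s i j.
Proof. by move=> rs bs xi yj; rewrite /= xi yj rs ?bs // ltnW. Qed.

(** [s0] is the state at the start of a round. While the flag is 0 the orientation is still that of
    [s0], so tests made at different moments concern the same orientation. *)
Definition progress s0 s :=
  [/\ boolean s, forall i j, oriented s i j -> F i j,
      forall i j, oriented s0 i j -> oriented s i j,
      var s 5 = 0 -> forall i j, oriented s i j = oriented s0 i j
    & var s 5 != 0 -> exists i j, oriented s i j && ~~ oriented s0 i j].

Lemma orient_if_ok s0 s e x y (i j : 'I_n) :
  rows s -> var s x = i -> var s y = j -> progress s0 s ->
  (eval e s != 0 -> F i j && ~~ oriented s i j) ->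
  progress s0 (run (orient_if e x y) s) /\
  (var (run (orient_if e x y) s) 5 = 0 -> var s 5 = 0 /\ eval e s = 0).
Proof.
move=> rs xi yj Ps; rewrite /orient_if !runE; case: eqP => [e0 _|/eqP e0 /(_ isT)/andP[Fij nij]].
  by split.
rewrite /= xi yj rs; last exact: ltnW.
case: Ps => bs sF s0s s5 s5'; set s' := set_var _ _ _.
have os' a b : oriented s' a b = ((a == i) && (b == j)) || oriented s a b.
  rewrite /oriented /s' /= /upd cell_inj; try exact: ltnW.
  by rewrite -!val_eqE; case: ifP.
split; last by [].
split.
- move=> a b; have := os' a b; rewrite /oriented /s' /= /upd cell_inj; try exact: ltnW.
  by rewrite -!val_eqE; case: ifP => // _ _; apply: bs.
- by move=> a b; rewrite os' => /orP[/andP[/eqP-> /eqP->] //|/sF].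
- by move=> a b /s0s; rewrite os' => ->; rewrite orbT.
- by [].
- by move=> _; exists i, j; rewrite os' !eqxx /=; apply: contra nij => /s0s.
Qed.

Definition full (o : rel 'I_n) := forall i j, inc i j -> o i j || o j i.

Definition forced (o : rel 'I_n) (b c d : nat) :=
  forall b' c' d' : 'I_n, b' = b :> nat -> c' = c :> nat -> d' = d :> nat ->
  (o b' c' -> inc b' d' -> ~~ inc c' d' -> o b' d') /\
  (o c' b' -> inc d' b' -> ~~ inc d' c' -> o d' b').

Lemma force_ok s0 s (b c d : 'I_n) :
  rows s -> var s 6 = b -> var s 7 = c -> var s 8 = d -> progress s0 s ->
  progress s0 (run force_cmd s) /\
  (var (run force_cmd s) 5 = 0 -> var s 5 = 0 /\ forced (oriented s0) b c d).
Proof.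
move=> rs sb sc sd P0; rewrite /force_cmd runE.
set e1 := ESub (inc_expr 6 8) _; set e2 := ESub (inc_expr 8 6) _.
have E1 : eval e1 s = (inc b d : nat) - (inc c d + (1 - oriented s b c + oriented s b d)).
  have bs : boolean s by case: P0.
  rewrite -(inc_exprE rs sb sd) -(inc_exprE rs sc sd).
  by rewrite -(oriented_exprE rs bs sb sc) -(oriented_exprE rs bs sb sd).
have FO : forall s, progress s0 s -> forall i j, oriented s i j -> F i j.
  by move=> s' [].
have [|P1 z1] := orient_if_ok (e := e1) rs sb sd P0.
  rewrite E1 => nz.
  have [ibd icd obc obd] : [/\ inc b d, ~~ inc c d, oriented s b c & ~~ oriented s b d].
    by move: nz; case: (inc b d) (inc c d) (oriented s b c) (oriented s b d) => [] [] [] [].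
  rewrite obd andbT; apply: (@lexico_forces _ _ inc_sym b c); last exact: FO P0 _ _ obc.
  have Gbc := lexico_edge (FO _ P0 _ _ obc).
  by rewrite /forces /= Gbc ibd eqxx icd.
set s1 := run (orient_if e1 6 8) s in P1 z1 *.
have fr := run_frame inp n (orient_if e1 6 8) s.
have rs1 : rows s1 by move=> i le_i; rewrite fr.2 // rs.
have sb1 : var s1 6 = b by rewrite fr.1.
have sc1 : var s1 7 = c by rewrite fr.1.
have sd1 : var s1 8 = d by rewrite fr.1.
have E2 : eval e2 s1 = (inc d b : nat) - (inc d c + (1 - oriented s1 c b + oriented s1 d b)).
  have bs : boolean s1 by case: P1.
  rewrite -(inc_exprE rs1 sd1 sb1) -(inc_exprE rs1 sd1 sc1).
  by rewrite -(oriented_exprE rs1 bs sc1 sb1) -(oriented_exprE rs1 bs sd1 sb1).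
have [|P2 z2] := orient_if_ok (e := e2) rs1 sd1 sb1 P1.
  rewrite E2 => nz.
  have [idb idc ocb odb] : [/\ inc d b, ~~ inc d c, oriented s1 c b & ~~ oriented s1 d b].
    by move: nz; case: (inc d b) (inc d c) (oriented s1 c b) (oriented s1 d b) => [] [] [] [].
  rewrite odb andbT; apply: (@lexico_forces _ _ inc_sym c b); last exact: FO P1 _ _ ocb.
  have Gcb := lexico_edge (FO _ P1 _ _ ocb).
  by rewrite /forces /= Gcb idb eqxx inc_sym idc orbT.
split => // /z2[f1 e20]; have [f0 e10] := z1 f1; split => //.
have o1 i j : oriented s1 i j = oriented s0 i j by case: P1 => _ _ _ /(_ f1).
have o0 i j : oriented s i j = oriented s0 i j by case: P0 => _ _ _ /(_ f0).
move=> b' c' d' /val_inj-> /val_inj-> /val_inj->; move: e10 e20; rewrite E1 E2 !o1 !o0.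
split.
  by case: (inc b d) (inc c d) (oriented s0 b c) (oriented s0 b d) e10 => [] [] [] [].
by case: (inc d b) (inc d c) (oriented s0 c b) (oriented s0 d b) e20 => [] [] [] [].
Qed.

Lemma force_pass_ok s0 s : rows s -> progress s0 s ->
  let s' := run (CFor 0 6 (CFor 0 7 (CFor 0 8 force_cmd))) s in
  progress s0 s' /\ (var s' 5 = 0 -> var s 5 = 0 /\
    forall b c d : 'I_n, forced (oriented s0) b c d).
Proof.
move=> rs P0.
have [] := @for_flag inp n 5 (progress s0)
  (fun b => forall c d, c < n -> d < n -> forced (oriented s0) b c d) 0 6
  (CFor 0 7 (CFor 0 8 force_cmd)) s isT P0; last first.
  move=> P1 h; split => // /h[f0 Q]; split => // b c d;
    exact: (Q b (ltn_ord b) c d (ltn_ord c) (ltn_ord d)).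
move=> b s1 ltb fr1 P1 _; set s2 := set_var s1 6 b.
have P2 : progress s0 s2 by exact: P1.
have [] := @for_flag inp n 5 (progress s0)
  (fun c => forall d, d < n -> forced (oriented s0) b c d) 0 7
  (CFor 0 8 force_cmd) s2 isT P2; last first.
  move=> P3 h; split => // /h[f0 Q]; split => // c d ltc; exact: (Q c ltc d).
move=> c s3 ltc fr3 P3 _; set s4 := set_var s3 7 c.
have P4 : progress s0 s4 by exact: P3.
have [] := @for_flag inp n 5 (progress s0)
  (fun d => forced (oriented s0) b c d) 0 8 force_cmd s4 isT P4; last first.
  move=> P5 h; split => // /h[f0 Q]; split => // d; exact: Q.
move=> d s5 ltd fr5 P5 _; set s6 := set_var s5 8 d.
have P6 : progress s0 s6 by exact: P5.
have := @force_ok s0 s6 (Ordinal ltb) (Ordinal ltc) (Ordinal ltd).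
apply=> //.
- by move=> i le_i; rewrite /= fr5.2 //= fr3.2 //= fr1.2 // rs.
- by rewrite /= /upd /= fr5.1 //= /upd /= fr3.1.
- by rewrite /= /upd /= fr5.1.
Qed.

Definition treated (o : rel 'I_n) (i j : nat) :=
  forall i' j' : 'I_n, i' = i :> nat -> j' = j :> nat -> inc i' j' -> o i' j' || o j' i'.

(** The last hypothesis supplies premises of [lexico_least]: closure under forcing, and no
    unoriented edge of smaller code. *)
Lemma pick_ok s0 s (i j : 'I_n) :
  rows s -> var s 6 = i -> var s 7 = j -> progress s0 s ->
  (var s 5 = 0 -> (forall b c d : 'I_n, forced (oriented s0) b c d) /\
    forall i' j' : nat, i' * n + j' < i * n + j -> j' < n -> treated (oriented s0) i' j') ->
  progress s0 (run pick_cmd s) /\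
  (var (run pick_cmd s) 5 = 0 -> var s 5 = 0 /\ treated (oriented s0) i j).
Proof.
move=> rs si sj P0 prev; rewrite /pick_cmd; set e := ESub _ _.
have E : eval e s = (inc i j : nat) - (oriented s i j + (oriented s j i + var s 5)).
  have bs : boolean s by case: P0.
  rewrite -(inc_exprE rs si sj).
  by rewrite -(oriented_exprE rs bs si sj) -(oriented_exprE rs bs sj si).
have [|P1 z1] := orient_if_ok (e := e) rs si sj P0.
  rewrite E => nz.
  have [iij oij oji f0] : [/\ inc i j, ~~ oriented s i j, ~~ oriented s j i & var s 5 = 0].
    move: nz; rewrite -lt0n subn_gt0; case: (inc i j) => //.
    by rewrite ltnS leqn0 !addn_eq0 !eqb0 => /and3P[-> -> /eqP->].
  have [fo tr] := prev f0; rewrite oij andbT.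
  have o0 a b : oriented s a b = oriented s0 a b by case: P0 => _ _ _ /(_ f0).
  rewrite !o0 in oij oji.
  apply: (lexico_least inc_sym (O := oriented s0)) => //.
  - by case: P0 => _ sF _ _ _ a b; rewrite -o0; apply: sF.
  - move=> [a b] [c d] /and3P[/= iab icd /orP[/andP[/eqP eac nbd]|/andP[/eqP ebd nac]]].
      rewrite eac => oab; rewrite eac in iab.
      by have [h _] := fo c b d c b d erefl erefl erefl; apply: h.
    rewrite ebd => oab; rewrite ebd in iab.
    have [_ h] := fo d a c d a c erefl erefl erefl; apply: h => //.
    by rewrite inc_sym.
  - move=> a b iab nab nba; rewrite leqNgt; apply/negP => lt.
    have := tr a b lt (ltn_ord b) a b erefl erefl iab.
    by rewrite (negPf nab) (negPf nba).
split => // /z1[f0 e0]; split => // i' j' /val_inj-> /val_inj->.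
have o0 a b : oriented s a b = oriented s0 a b by case: P0 => _ _ _ /(_ f0).
by move: e0; rewrite E f0 !o0; case: (inc i j) (oriented s0 i j) (oriented s0 j i) => [] [] [].
Qed.

Lemma pick_pass_ok s0 s : rows s -> progress s0 s ->
  (var s 5 = 0 -> forall b c d : 'I_n, forced (oriented s0) b c d) ->
  let s' := run (CFor 0 6 (CFor 0 7 pick_cmd)) s in
  progress s0 s' /\ (var s' 5 = 0 -> full (oriented s0)).
Proof.
move=> rs P0 fo.
have [] := @for_flag inp n 5 (progress s0)
  (fun i => forall j, j < n -> treated (oriented s0) i j) 0 6
  (CFor 0 7 pick_cmd) s isT P0; last first.
  move=> P1 h; split => // /h[_ Q] i j; exact: (Q i (ltn_ord i) j (ltn_ord j) i j erefl erefl).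
move=> i s1 lti fr1 P1 prev1; set s2 := set_var s1 6 i.
have P2 : progress s0 s2 by exact: P1.
have [] := @for_flag inp n 5 (progress s0)
  (fun j => treated (oriented s0) i j) 0 7 pick_cmd s2 isT P2; last first.
  move=> P3 h; split => // /h[f0 Q]; split => // j ltj; exact: (Q j ltj).
move=> j s3 ltj fr3 P3 prev3; set s4 := set_var s3 7 j.
have P4 : progress s0 s4 by exact: P3.
have := @pick_ok s0 s4 (Ordinal lti) (Ordinal ltj).
apply=> //.
- by move=> k le_k; rewrite /= fr3.2 //= fr1.2 // rs.
- by rewrite /= /upd /= fr3.1.
- move=> f4; have [f2 Qj] := prev3 f4; have [f0 Qi] := prev1 f2; split; first exact: fo.
  move=> i' j' /= lt ltj'; case: (ltnP i' i) => [lt_i|le_i]; first exact: Qi.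
  have n0 : 0 < n by apply: leq_ltn_trans ltj.
  have ei : i' = i.
    apply/anti_leq; rewrite le_i andbT -ltnS -(ltn_pmul2r n0) mulSn addnC.
    by apply: leq_ltn_trans (leq_addr j' _) (leq_trans lt _); rewrite leq_add2l ltnW.
  by rewrite ei; apply: Qj; rewrite ei ltn_add2l in lt.
Qed.

Definition good s :=
  [/\ var s 0 = n, rows s, boolean s & forall i j, oriented s i j -> F i j].

Lemma round_ok s : good s ->
  [/\ good (run round_cmd s), forall i j, oriented s i j -> oriented (run round_cmd s) i j
    & full (oriented s) \/ exists i j, oriented (run round_cmd s) i j && ~~ oriented s i j].
Proof.
move=> [s0 rs bs sF]; have fr := run_frame inp n round_cmd s.
have P1 : progress s (set_var s 5 0) by split.
have [P2 h2] := force_pass_ok (s := set_var s 5 0) rs P1.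
rewrite /round_cmd !runE /= in fr *; set s2 := run _ (set_var s 5 0) in fr P2 h2 *.
have rs2 : rows s2.
  by move=> i le_i; rewrite /s2 (run_frame inp n _ _).2 //= rs.
have [P3 h3] := pick_pass_ok rs2 P2 (fun f => (h2 f).2).
set s3 := run _ s2 in fr P3 h3 *.
case: (P3) => bs3 s3F mono eq3 new3; split.
- by split => //; [rewrite fr.1 | move=> i le_i; rewrite fr.2 // rs].
- exact: mono.
- by case: (var s3 5 =P 0) => [/h3|/eqP/new3]; [left | right].
Qed.

Definition measure s := #|[set p : 'I_n * 'I_n | oriented s p.1 p.2]|.

Lemma orientation_ok s : var s 0 = n -> rows s -> (forall i, arr s 1 i = 0) ->
  let s' := run orientation_cmd s in
  [/\ var s' 0 = n, rows s' & forall i j : 'I_n, arr s' 1 (i * n.+1 + j) = F i j].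
Proof.
(* After [t] rounds the orientation is complete or has at least [t] pairs; for t = n * n the second
   case contains all ordered pairs and is complete too. *)
move=> s0 rs a0; pose J t s := good s /\ (full (oriented s) \/ t <= measure s).
have J0 : J 0 s.
  split; last by right.
  by split => // i j; rewrite /oriented a0.
have Jstep t s1 : J t s1 -> J t.+1 (run round_cmd s1).
  move=> [g1 h1]; have [g2 mono new] := round_ok g1; split => //.
  have mfull : full (oriented s1) -> full (oriented (run round_cmd s1)).
    by move=> fu i j /fu/orP[/mono->|/mono->]; rewrite ?orbT.
  case: new => [/mfull|[i [j /andP[oij nij]]]]; first by left.
  case: h1 => [/mfull|le_t]; [by left | right].
  apply: leq_ltn_trans le_t _; apply: proper_card; apply/properP; split.
    by apply/subsetP => -[a b]; rewrite !inE; apply: mono.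
  by exists (i, j); rewrite !inE.
have J_set t s1 r v : 1 < r -> J t s1 -> J t (set_var s1 r v).
  move=> r1 [[h0 h1 h2 h3] h4]; split => //; split => //.
  by rewrite /= upd_neq //; case: r r1.
have : J (n * n) (run orientation_cmd s).
  apply: (@for_ind inp n (fun u => J (u * n))) => // u s1 _ _ Ju.
  rewrite mulSn addnC; apply: (@for_ind inp n (fun v => J (u * n + v))).
    by rewrite addn0; apply: J_set.
  by move=> v s2 _ _ Jv; rewrite addnS; apply: Jstep; apply: J_set.
set s' := run _ _ => -[[h0 h1 h2 h3] h4] /=; split => // i j; rewrite h2; congr nat_of_bool.
have fu : full (oriented s').
  case: h4 => // le_n a b iab.
  have : [set p : 'I_n * 'I_n | oriented s' p.1 p.2] = setT.
    apply/eqP; rewrite eqEcard subsetT /=; apply: leq_trans le_n.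
    by rewrite cardsT card_prod card_ord.
  by move/setP/(_ (a, b)); rewrite !inE /= => ->.
(* A pair of [F] that is not oriented would be oriented backwards, against the asymmetry of [F]. *)
apply/idP/idP => [|Fij]; first exact: h3.
have /orP[//|/h3 Fji] := fu _ _ (lexico_edge Fij).
by have := lexico_asym inc_sym inc_irr R_trans R_inc Fij; rewrite Fji.
Qed.

End Algorithm.

(* [le] counts the element itself, so the positions computed here start at 1. *)
Definition positions_cmd : cmd :=
  CFor 0 6 (CSeq (CSeq (CSet 9 (EC 0)) (CSet 10 (EC 0)))
    (CSeq (CFor 0 7
             (CSeq (CSet 9 (EAdd (EV 9) (EAdd (le_expr 7 6) (oriented_expr 7 6))))
                   (CSet 10 (EAdd (EV 10) (EAdd (le_expr 7 6) (oriented_expr 6 7))))))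
          (CPut 2 (EV 9) (EV 10)))).

(** * Computing positions and heights *)

Section Positions.

Variables (n : nat) (inp : nat -> nat) (le F : rel 'I_n).
Hypothesis inpE : forall i j : 'I_n, inp (i * n + j) = le i j.

Notation run := (run inp n).
Notation eval := (eval inp).

(** For a transitive orientation [F] of the incomparability graph, these are the ranks in the union
    of [le] with [F], resp. with the reverse of [F]. The first gives the position, the second the
    height. *)
Definition rank1 (i : 'I_n) := \sum_(j < n) (le j i + F j i).
Definition rank2 (i : 'I_n) := \sum_(j < n) (le j i + F i j).

Lemma big_ord_lt_recr (f : 'I_n -> nat) k (lt : k < n) :
  \sum_(j < n | j < k.+1) f j = \sum_(j < n | j < k) f j + f (Ordinal lt).
Proof.
rewrite (bigD1 (Ordinal lt)) //= addnC; congr (_ + _); apply: eq_bigl => j.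
by rewrite ltnS -val_eqE /= andbC -ltn_neqAle.
Qed.

Lemma positions_ok s :
  rows n s -> (forall i j : 'I_n, arr s 1 (i * n.+1 + j) = F i j) -> injective rank1 ->
  forall i, arr (run positions_cmd s) 2 (rank1 i) = rank2 i.
Proof.
move=> rs os r_inj.
suff H : forall i : 'I_n, i < 0 + n -> arr (run positions_cmd s) 2 (rank1 i) = rank2 i.
  by move=> i; apply: H.
apply: (@for_ind inp n (fun k s' => forall i : 'I_n, i < k -> arr s' 2 (rank1 i) = rank2 i)) => //.
move=> k s1 ltk fr1 done_k; rewrite !runE; set s2 := set_var _ 10 _.
set c := CSeq (CSet 9 _) _; pose s3 := run (CFor 0 7 c) s2; rewrite -/s3.
pose ok := Ordinal ltk.
have [h9 h10] : var s3 9 = rank1 ok /\ var s3 10 = rank2 ok.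
  have -> : rank1 ok = \sum_(j < n | j < n) (le j ok + F j ok).
    by apply: eq_bigl => j; rewrite ltn_ord.
  have -> : rank2 ok = \sum_(j < n | j < n) (le j ok + F ok j).
    by apply: eq_bigl => j; rewrite ltn_ord.
  apply: (@for_ind inp n (fun m s' =>
    var s' 9 = \sum_(j < n | j < m) (le j ok + F j ok) /\
    var s' 10 = \sum_(j < n | j < m) (le j ok + F ok j))).
    by rewrite !big_pred0.
  move=> m s4 ltm fr4 [h9 h10]; set s5 := set_var s4 7 m.
  have rs5 : rows n s5 by move=> i le_i; rewrite /= fr4.2 //= fr1.2 // rs.
  have s57 : var s5 7 = Ordinal ltm by [].
  have s56 : var s5 6 = ok by rewrite /= /upd /= fr4.1.
  have l1 := le_exprE inpE rs5 s57 s56.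
  have a5 : arr s5 1 = arr s 1 by rewrite /= fr4.2 //= fr1.2.
  have o1 : eval (oriented_expr 7 6) s5 = F (Ordinal ltm) ok.
    rewrite /oriented_expr /cell.
    rewrite -[eval _ _]/(arr s5 1 (arr s5 0 (var s5 7) + var s5 6)) s57 s56 rs5; last exact: ltnW.
    by rewrite a5 os.
  have o2 : eval (oriented_expr 6 7) s5 = F ok (Ordinal ltm).
    rewrite /oriented_expr /cell.
    rewrite -[eval _ _]/(arr s5 1 (arr s5 0 (var s5 6) + var s5 7)) s57 s56 rs5; last exact: ltnW.
    by rewrite a5 os.
  rewrite /c !runE; split.
    rewrite -[LHS]/(var s4 9 + (eval (le_expr 7 6) s5 + eval (oriented_expr 7 6) s5)).
    by rewrite l1 o1 h9 big_ord_lt_recr.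
  rewrite -[LHS]/(var s4 10 + (eval (le_expr 7 6) s5 + eval (oriented_expr 6 7) s5)).
  by rewrite l1 o2 h10 big_ord_lt_recr.
move=> i; rewrite ltnS leq_eqVlt => /orP[/eqP ei|lt].
  have -> : i = ok by apply: val_inj.
  by rewrite /= /upd h9 eqxx h10.
rewrite /= /upd h9; case: eqP => [/r_inj ei|_]; first by rewrite ei ltnn in lt.
by rewrite /s3 (run_frame inp n _ _).2 //= done_k.
Qed.

End Positions.

(* [extensions H k a b f] counts the ways of completing a pair of partial     *)
(* downsets (A, B), decided on the elements of position >= k, with a and b    *)
(* the greatest heights in A and B. The flag f is 0 if A = B so far; else the *)
(* topmost element of the symmetric difference is in B, and its lowest one    *)
(* is in B if f = 1 and in A if f = 2. [H k] is the height of the element of  *)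
(* position k, which is forced into A if a exceeds it.                        *)
Fixpoint extensions (H : nat -> nat) (k a b f : nat) : nat :=
  if k is k'.+1 then
    let h := H k' in
    extensions H k' (maxn a h) (maxn b h) f +
    (if (b < h) && (f != 0) then extensions H k' (maxn a h) b 2 else 0) +
    (if a < h then extensions H k' a (maxn b h) 1 else 0) +
    (if (a < h) && (b < h) then extensions H k' a b f else 0)
  else f == 2.

Definition max_expr (x y : reg) : expr := EAdd (EV x) (ESub (EV y) (EV x)).
Definition offset (x y : reg) : expr := EAdd (EV 11) (cell x y).
Definition accum (r k : nat) : cmd := CSet r (EAdd (EV r) (EArr k (EV 16))).

(** Variables 14 and 15 hold the updated greatest heights, 16 an address, and 17, 18, 19 the sums
    for the flags 0, 1, 2. The array that is read encodes the flag after the step: an element only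
    in B leads to flag 1 (array 4), one only in A to flag 2 (array 5). *)
Definition entry_cmd : cmd :=
  CSeq (CSeq (CSeq (CSet 14 (max_expr 6 13)) (CSet 15 (max_expr 7 13)))
             (CSeq (CSet 17 (EC 0)) (CSeq (CSet 18 (EC 0)) (CSet 19 (EC 0)))))
  (CSeq (CSeq (CSet 16 (offset 14 15))
        (CSeq (accum 17 3) (CSeq (accum 18 4) (accum 19 5))))
  (CSeq (CIf (ESub (EV 13) (EV 7))
          (CSeq (CSet 16 (offset 14 7)) (CSeq (accum 18 5) (accum 19 5))))
  (CSeq (CIf (ESub (EV 13) (EV 6))
          (CSeq (CSeq (CSet 16 (offset 6 15))
                (CSeq (accum 17 4) (CSeq (accum 18 4) (accum 19 4))))
          (CIf (ESub (EV 13) (EV 7))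
            (CSeq (CSet 16 (offset 6 7))
                (CSeq (accum 17 3) (CSeq (accum 18 4) (accum 19 5)))))))
  (CSeq (CSet 16 (EAdd (EV 2) (offset 6 7)))
  (CSeq (CPut 3 (EV 16) (EV 17))
  (CSeq (CPut 4 (EV 16) (EV 18)) (CPut 5 (EV 16) (EV 19)))))))).

(** In layer 0 only flag 2 counts, so array 5 alone is initialized, the others being 0 from the
    start. The height at position [k] is in cell k + 1 of array 2, as ranks start at 1. *)
Definition count_cmd : cmd :=
  CSeq (CFor 1 6 (CFor 1 7 (CPut 5 (cell 6 7) (EC 1))))
  (CSeq (CSet 11 (EC 0))
  (CFor 0 3 (CSeq (CSet 13 (EArr 2 (EAdd (EV 3) (EC 1))))
            (CSeq (CFor 1 6 (CFor 1 7 entry_cmd))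
                  (CSet 11 (EAdd (EV 11) (EV 2))))))).

(** * Filling the table of the dynamic program *)

Section Counting.

Variables (n : nat) (inp : nat -> nat) (H : nat -> nat).
Hypothesis H_le : forall k, k < n -> H k <= n.

Notation run := (run inp n).
Notation eval := (eval inp).

Definition pos3 (k a b : nat) := k * (n.+1 * n.+1) + (a * n.+1 + b).

Lemma pos3_inj k a b k' a' b' : a <= n -> b <= n -> a' <= n -> b' <= n ->
  (pos3 k a b == pos3 k' a' b') = [&& k == k', a == a' & b == b'].
Proof.
move=> le_a le_b le_a' le_b'.
have lt x y : x <= n -> y <= n -> x * n.+1 + y < n.+1 * n.+1.
  move=> le_x le_y; apply: (@leq_trans (x.+1 * n.+1)); last by rewrite leq_mul2r ltnS le_x orbT.
  by rewrite mulSnr ltn_add2l.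
apply/eqP/and3P => [e|[/eqP-> /eqP-> /eqP->] //].
have ek : k = k'.
  by have := congr1 (divn^~ (n.+1 * n.+1)) e;
    rewrite /pos3 !divnMDl ?muln_gt0 // !divn_small ?lt // !addn0.
move: e; rewrite /pos3 ek => /addnI/eqP; rewrite (cell_inj _ _ le_b le_b') => /andP[ea eb].
by split; rewrite ?eqxx.
Qed.

Definition layer s k := forall a b f, a <= n -> b <= n -> f < 3 ->
  arr s (3 + f) (pos3 k a b) = extensions H k a b f.

Lemma run_if_sub x y c s :
  run (CIf (ESub (EV x) (EV y)) c) s = if var s y < var s x then run c s else s.
Proof. by rewrite (runE inp n).2 -[eval _ _]/(var s x - var s y) subn_eq0 leqNgt; case: ltnP. Qed.

Lemma run_seq c1 c2 s : run (CSeq c1 c2) s = run c2 (run c1 s).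
Proof. by []. Qed.

Lemma run_seq5 c1 c2 c3 c4 c5 s :
  run (CSeq c1 (CSeq c2 (CSeq c3 (CSeq c4 c5)))) s = run c5 (run c4 (run c3 (run c2 (run c1 s)))).
Proof. by []. Qed.

Lemma entry_ok s k a b :
  rows n s -> var s 2 = n.+1 * n.+1 -> var s 11 = k * (n.+1 * n.+1) ->
  var s 6 = a -> var s 7 = b -> var s 13 = H k -> k < n -> a <= n -> b <= n ->
  layer s k ->
  let s' := run entry_cmd s in
  (forall f, f < 3 -> arr s' (3 + f) (pos3 k.+1 a b) = extensions H k.+1 a b f) /\
  (forall f k' a' b', f < 3 -> a' <= n -> b' <= n -> ~~ [&& k' == k.+1, a' == a & b' == b] ->
     arr s' (3 + f) (pos3 k' a' b') = arr s (3 + f) (pos3 k' a' b')).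
Proof.
move=> rs v2 v11 v6 v7 v13 lt_k le_a le_b lay; set h := H k in v13.
have le_h : h <= n := H_le lt_k.
rewrite /entry_cmd; set c1 := CSeq (CSeq (CSet 14 _) _) _; set c2 := CSeq (CSet 16 _) _;
  set c3 := CIf (ESub (EV 13) (EV 7)) _.
set c4 := CIf (ESub (EV 13) (EV 6)) _; set c5 := CSeq (CSet 16 _) _.
rewrite run_seq5; set s1 := run c1 s.
have [w14 w15] : var s1 14 = maxn a h /\ var s1 15 = maxn b h.
  by rewrite /s1 /c1 !runE /= /upd /= v6 v7 v13 !maxnE.
have fr1 := run_frame inp n c1 s.
have [w2 w6 w7 w11 w13] : [/\ var s1 2 = n.+1 * n.+1, var s1 6 = a, var s1 7 = b,
    var s1 11 = k * (n.+1 * n.+1) & var s1 13 = h] by rewrite !fr1.1.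
pose Inv p x0 x1 x2 s' := [/\ arr s' = arr s /\ (forall r, r < 16 -> var s' r = var s1 r),
  var s' 16 = p, var s' 17 = x0, var s' 18 = x1 & var s' 19 = x2].
pose E := extensions H k.
have keep s' r v : (forall q, q < 16 -> var s' q = var s1 q) -> 15 < r ->
    forall q, q < 16 -> var (set_var s' r v) q = var s1 q.
  by move=> es r16 q q16; rewrite /= upd_neq ?es // ltn_eqF // (leq_trans q16).
have load p x0 x1 x2 s' x y a' b' : x < 16 -> y < 16 ->
    var s1 x = a' -> var s1 y = b' -> a' <= n -> Inv p x0 x1 x2 s' ->
    Inv (pos3 k a' b') x0 x1 x2 (run (CSet 16 (offset x y)) s').
  move=> ltx lty xa yb le_a' [[ea er] _ h0 h1 h2]; rewrite runE.
  split; [split => //; exact: keep | | exact: h0 | exact: h1 | exact: h2].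
  by rewrite /= /upd /= ea !er // w11 xa yb rs.
have cellE a' b' f : f < 3 -> a' <= n -> b' <= n -> arr s (3 + f) (pos3 k a' b') = E a' b' f.
  by move=> ltf le_a' le_b'; apply: lay.
have acc0 f x0 x1 x2 s' a' b' : f < 3 -> a' <= n -> b' <= n ->
    Inv (pos3 k a' b') x0 x1 x2 s' ->
    Inv (pos3 k a' b') (x0 + E a' b' f) x1 x2 (run (accum 17 (3 + f)) s').
  move=> ltf le_a' le_b' [[ea er] hp h0 h1 h2]; rewrite /accum runE.
  split; [split => //; exact: keep | exact: hp | | exact: h1 | exact: h2].
  by rewrite /= /upd /= h0 hp ea cellE.
have acc1 f x0 x1 x2 s' a' b' : f < 3 -> a' <= n -> b' <= n ->
    Inv (pos3 k a' b') x0 x1 x2 s' ->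
    Inv (pos3 k a' b') x0 (x1 + E a' b' f) x2 (run (accum 18 (3 + f)) s').
  move=> ltf le_a' le_b' [[ea er] hp h0 h1 h2]; rewrite /accum runE.
  split; [split => //; exact: keep | exact: hp | exact: h0 | | exact: h2].
  by rewrite /= /upd /= h1 hp ea cellE.
have acc2 f x0 x1 x2 s' a' b' : f < 3 -> a' <= n -> b' <= n ->
    Inv (pos3 k a' b') x0 x1 x2 s' ->
    Inv (pos3 k a' b') x0 x1 (x2 + E a' b' f) (run (accum 19 (3 + f)) s').
  move=> ltf le_a' le_b' [[ea er] hp h0 h1 h2]; rewrite /accum runE.
  split; [split => //; exact: keep | exact: hp | exact: h0 | exact: h1 | ].
  by rewrite /= /upd /= h2 hp ea cellE.
have I0 : Inv (var s1 16) 0 0 0 s1.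
  by split => //; rewrite /s1 /c1 !runE /= /upd /=.
clearbody s1.
have le_ma : maxn a h <= n by rewrite geq_max le_a.
have le_mb : maxn b h <= n by rewrite geq_max le_b.
(* With flag 0 the summand for an element only in A vanishes: the topmost difference would be in
   A. *)
pose z0 := E (maxn a h) (maxn b h) 0 + 0 + (if a < h then E a (maxn b h) 1 else 0) +
  (if (a < h) && (b < h) then E a b 0 else 0).
pose y f := E (maxn a h) (maxn b h) f + (if b < h then E (maxn a h) b 2 else 0) +
  (if a < h then E a (maxn b h) 1 else 0) + (if (a < h) && (b < h) then E a b f else 0).
have [p Ifin] : exists p, Inv p z0 (y 1) (y 2) (run c4 (run c3 (run c2 s1))).
  rewrite /z0 /y.
  have I1 : Inv (pos3 k (maxn a h) (maxn b h)) (E (maxn a h) (maxn b h) 0)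
              (E (maxn a h) (maxn b h) 1) (E (maxn a h) (maxn b h) 2) (run c2 s1).
    rewrite /c2 !run_seq; apply: (acc2 2 _ _ 0) => //; apply: (acc1 1 _ 0) => //.
    by apply: (acc0 0 0) => //; apply: load I0.
  have [q I2] : exists q, Inv q (E (maxn a h) (maxn b h) 0)
      (E (maxn a h) (maxn b h) 1 + (if b < h then E (maxn a h) b 2 else 0))
      (E (maxn a h) (maxn b h) 2 + (if b < h then E (maxn a h) b 2 else 0)) (run c3 (run c2 s1)).
    have [[_ er] _ _ _ _] := I1; rewrite /c3 run_if_sub !er // w7 w13.
    case: (b < h); last by rewrite !addn0; eexists; exact: I1.
    exists (pos3 k (maxn a h) b); rewrite !run_seq.
    by apply: (acc2 2) => //; apply: (acc1 2) => //; apply: load I1.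
  have [[_ er] _ _ _ _] := I2; rewrite /c4 run_if_sub !er // w6 w13.
  case: (a < h) => /=; last by rewrite !addn0; exists q.
  rewrite run_seq; set s3 := run (CSeq (CSet 16 (offset 6 15)) _) _.
  have I3 : Inv (pos3 k a (maxn b h)) (E (maxn a h) (maxn b h) 0 + 0 + E a (maxn b h) 1)
      (E (maxn a h) (maxn b h) 1 + (if b < h then E (maxn a h) b 2 else 0) + E a (maxn b h) 1)
      (E (maxn a h) (maxn b h) 2 + (if b < h then E (maxn a h) b 2 else 0) + E a (maxn b h) 1) s3.
    rewrite addn0 /s3 !run_seq; apply: (acc2 1) => //; apply: (acc1 1) => //.
    by apply: (acc0 1) => //; apply: load I2.
  have [[_ er3] _ _ _ _] := I3; rewrite run_if_sub !er3 // w7 w13.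
  case: (b < h) I3 => I3; last by rewrite !addn0 in I3 *; eexists; exact: I3.
  exists (pos3 k a b); rewrite !run_seq; apply: (acc2 2) => //; apply: (acc1 1) => //.
  by apply: (acc0 0) => //; apply: load I3.
have [[ea er] _ h0 h1 h2] := Ifin; move: (run c4 _) ea er h0 h1 h2 => s3 ea er h0 h1 h2.
have E16 : eval (EAdd (EV 2) (offset 6 7)) s3 = pos3 k.+1 a b.
  by rewrite /= ea !er // w2 w6 w7 w11 rs // /pos3 mulSn addnA.
have -> : run c5 s3 = set_arr (set_arr (set_arr (set_var s3 16 (pos3 k.+1 a b))
    3 (pos3 k.+1 a b) z0) 4 (pos3 k.+1 a b) (y 1)) 5 (pos3 k.+1 a b) (y 2).
  by rewrite /c5 !runE E16 /= /upd /= h0 h1 h2.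
split.
- by case=> [|[|[|//]]] _; rewrite /= /upd eqxx /= ?andbF ?andbT.
- move=> f k' a' b' ltf le_a' le_b' ne.
  have {}ne : (pos3 k' a' b' == pos3 k.+1 a b) = false.
    by rewrite pos3_inj //; apply: negbTE.
  by case: f ltf => [|[|[|//]]] _; rewrite /= /upd ne ea.
Qed.

Lemma count_ok s :
  rows n s -> var s 2 = n.+1 * n.+1 -> (forall k, k < n -> arr s 2 k.+1 = H k) ->
  (forall i, arr s 3 i = 0) -> (forall i, arr s 4 i = 0) ->
  eval (EArr 3 (EV 11)) (run count_cmd s) = extensions H n 0 0 0.
Proof.
move=> rs v2 hH z3 z4; rewrite /count_cmd !run_seq.
set init := CFor 1 6 (CFor 1 7 (CPut _ _ _)); set s1 := run init s;
  have fr1 := run_frame inp n init s.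
have lay1 : layer s1 0.
  suff init_ok : forall a b, a < 1 + n -> b <= n -> arr s1 5 (a * n.+1 + b) = 1.
    move=> a b f le_a le_b; rewrite /pos3 mul0n add0n.
    case: f => [|[|[|//]]] _ /=; first by rewrite -[3 + 0]/3 fr1.2 ?z3.
      by rewrite -[3 + 1]/4 fr1.2 ?z4.
    exact: init_ok.
  apply: (@for_ind inp n (fun a s' => forall a' b, a' < a -> b <= n ->
    arr s' 5 (a' * n.+1 + b) = 1)) => // a s2 lt_a fr2 done_a.
  suff in_ok : (forall a' b, a' < a -> b <= n ->
       arr (run (CFor 1 7 (CPut 5 (cell 6 7) (EC 1))) (set_var s2 6 a)) 5 (a' * n.+1 + b) = 1) /\
     (forall b, b < 1 + n ->
       arr (run (CFor 1 7 (CPut 5 (cell 6 7) (EC 1))) (set_var s2 6 a)) 5 (a * n.+1 + b) = 1).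
    move=> a' b; rewrite ltnS leq_eqVlt => /orP[/eqP->|lt] le_b; first exact: in_ok.2.
    exact: in_ok.1.
  apply: (@for_ind inp n (fun b s' => (forall a' b', a' < a -> b' <= n ->
      arr s' 5 (a' * n.+1 + b') = 1) /\
    (forall b', b' < b -> arr s' 5 (a * n.+1 + b') = 1))) => //.
  move=> b s3 lt_b fr3 [old new]; rewrite runE /=.
  have -> : arr s3 0 (upd (var s3) 7 b 6) = a * n.+1.
    by rewrite /upd /= fr3.1 //= /upd /= fr3.2 //= fr2.2 // rs.
  rewrite /upd /=; split.
    by move=> a' b' lt' le'; case: eqP => // _; apply: old.
  move=> b'; rewrite ltnS leq_eqVlt => /orP[/eqP->|lt']; first by rewrite eqxx.
  by case: eqP => // _; apply: new.
have rs1 : rows n s1 by move=> i le_i; rewrite fr1.2 // rs.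
have v21 : var s1 2 = n.+1 * n.+1 by rewrite fr1.1.
have hH1 k : k < n -> arr s1 2 k.+1 = H k by move=> ltk; rewrite fr1.2 // hH.
clearbody s1; rewrite [run (CSet 11 _) _]runE; set s2 := set_var s1 11 _;
  set c := CSeq (CSet 13 _) _.
suff [w11 lay] : var (run (CFor 0 3 c) s2) 11 = (0 + n) * (n.+1 * n.+1) /\
    layer (run (CFor 0 3 c) s2) n.
  rewrite -[eval _ _]/(arr (run (CFor 0 3 c) s2) (3 + 0) (var (run (CFor 0 3 c) s2) 11)).
  rewrite w11; have := lay 0 0 0 (leq0n n) (leq0n n) isT.
  by rewrite /pos3 mul0n !addn0.
apply: (@for_ind inp n (fun k s' => var s' 11 = k * (n.+1 * n.+1) /\ layer s' k)).
  by split.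
move=> k s3 lt_k fr3 [w11 lay]; rewrite /c !run_seq; set s4 := run (CSet 13 _) _.
have [h2 h11 h13] : [/\ var s4 2 = n.+1 * n.+1, var s4 11 = k * (n.+1 * n.+1) & var s4 13 = H k].
  by rewrite /s4 runE /= /upd /= addn1 fr3.2 //= hH1 // fr3.1.
have rs4 : rows n s4 by move=> i le_i; rewrite /s4 runE /= fr3.2 // rs1.
have lay4 : layer s4 k by [].
clearbody s4; set loop := CFor 1 6 _; have fr5 := run_frame inp n loop s4.
suff lay5 : forall a b f, a < 1 + n -> b <= n -> f < 3 ->
    arr (run loop s4) (3 + f) (pos3 k.+1 a b) = extensions H k.+1 a b f.
  rewrite runE; split; last by move=> a b f le_a; apply: lay5.
  by rewrite /= /upd /= !fr5.1 // h11 h2 mulSn addnC.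
suff [] : layer (run loop s4) k /\ forall a b f, a < 1 + n -> b <= n -> f < 3 ->
    arr (run loop s4) (3 + f) (pos3 k.+1 a b) = extensions H k.+1 a b f by [].
apply: (@for_ind inp n (fun a s' => layer s' k /\ forall a' b f, a' < a -> b <= n -> f < 3 ->
    arr s' (3 + f) (pos3 k.+1 a' b) = extensions H k.+1 a' b f)); first by split.
move=> a s6 lt_a fr6 [lay6 done6]; set s7 := set_var s6 6 a.
suff [] : [/\ layer (run (CFor 1 7 entry_cmd) s7) k,
    forall a' b f, a' < a -> b <= n -> f < 3 ->
      arr (run (CFor 1 7 entry_cmd) s7) (3 + f) (pos3 k.+1 a' b) = extensions H k.+1 a' b f
    & forall b f, b < 1 + n -> f < 3 ->
      arr (run (CFor 1 7 entry_cmd) s7) (3 + f) (pos3 k.+1 a b) = extensions H k.+1 a b f].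
  move=> l old new; split => // a' b f; rewrite ltnS leq_eqVlt => /orP[/eqP->|lt'] le_b ltf.
    exact: new.
  exact: old.
apply: (@for_ind inp n (fun b s' => [/\ layer s' k,
    forall a' b f, a' < a -> b <= n -> f < 3 ->
      arr s' (3 + f) (pos3 k.+1 a' b) = extensions H k.+1 a' b f
    & forall b' f, b' < b -> f < 3 ->
      arr s' (3 + f) (pos3 k.+1 a b') = extensions H k.+1 a b' f])); first by split.
move=> b s8 lt_b fr8 [lay8 old new]; set s9 := set_var s8 7 b.
have [||||||||||new9 old9] := @entry_ok s9 k a b.
- by move=> i le_i; rewrite /= fr8.2 //= fr6.2 // rs4.
- by rewrite /= /upd /= fr8.1 //= /upd /= fr6.1.
- by rewrite /= /upd /= fr8.1 //= /upd /= fr6.1.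
- by rewrite /= /upd /= fr8.1.
- by [].
- by rewrite /= /upd /= fr8.1 //= /upd /= fr6.1.
- exact: lt_k.
- by rewrite -ltnS.
- by rewrite -ltnS.
- exact: lay8.
have le_a : a <= n by rewrite -ltnS.
have le_b : b <= n by rewrite -ltnS.
split.
- by move=> a' b' f le_a' le_b' ltf; rewrite old9 ?lay8 // ltn_eqF.
- move=> a' b' f lt_a' le_b' ltf; rewrite old9 ?old //; last by rewrite (ltn_eqF lt_a') andbF.
  exact: leq_trans (ltnW lt_a') le_a.
- move=> b' f; rewrite ltnS leq_eqVlt => /orP[/eqP->|lt'] ltf; first exact: new9.
  rewrite old9 ?new //; first exact: leq_trans (ltnW lt') le_b.
  by rewrite (ltn_eqF lt') !andbF.
Qed.

End Counting.

(** * The diameter of the downset lattice *)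

Lemma big_subset_setU1 (T : finType) (x : T) (S : {set T}) (f : {set T} -> nat) :
  x \notin S ->
  \sum_(A : {set T} | A \subset x |: S) f A =
  \sum_(A : {set T} | A \subset S) (f A + f (x |: A)).
Proof.
move=> xS; rewrite big_split /= addnC (bigID (fun A : {set T} => x \in A)) /=.
congr (_ + _).
  rewrite (reindex_onto (fun A => x |: A) (fun A => A :\ x)) /=; last first.
    by move=> A /andP[_ xA]; rewrite setD1K.
  apply: eq_bigl => A; rewrite setU11 andbT.
  apply/andP/idP => [[sA /eqP <-]|sA].
    apply/subsetP => z; rewrite !inE => /andP[zx]; rewrite (negPf zx) /= => zA.
    by move/subsetP/(_ z): sA; rewrite !inE zA (negPf zx) /=; apply.
  have xA : x \notin A by apply: contra xS; apply: (subsetP sA).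
  by rewrite setUS // setU1K.
apply: eq_bigl => A; apply/andP/idP => [[sA xA]|sA].
  apply/subsetP => z zA; move/subsetP/(_ z zA): sA; rewrite !inE => /orP[/eqP e|//].
  by rewrite -e zA in xA.
by split; [apply: subset_trans sA (subsetUr _ _) | apply: contra xS; apply: (subsetP sA)].
Qed.

(** Let p = a0 b1, q = a1 b0, t = c1 d0, r = c0 d1. Then p, q <= t and p q <= t r, and (t - p)(t -
    q) >= 0 gives p + q <= t + r, the mixed terms of the products. *)
Lemma four_numbers a0 a1 b0 b1 c0 c1 d0 d1 :
  a0 * b0 <= c0 * d0 -> a0 * b1 <= c1 * d0 -> a1 * b0 <= c1 * d0 ->
  a1 * b1 <= c1 * d1 -> (a0 + a1) * (b0 + b1) <= (c0 + c1) * (d0 + d1).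
Proof.
move=> h00 h01 h10 h11.
set p := a0 * b1 in h01 *; set q := a1 * b0 in h10 *; set t := c1 * d0 in h01 h10 *.
have pq : p * q <= t * (c0 * d1).
  by have := leq_mul h00 h11; rewrite /p /q /t; nia.
suff : p + q <= t + c0 * d1 by rewrite /p /q /t; nia.
move: (c0 * d1) pq h01 h10 => r pq pt qt.
case: (posnP t) => [t0|t0]; first by lia.
have : (p + q) * t <= (t + r) * t by nia.
by rewrite leq_pmul2r.
Qed.

(** The theorem of Ahlswede and Daykin. Summing out one element [x] replaces each f by the function
    A -> f A + f (x |: A), and [four_numbers] preserves the hypothesis. *)
Lemma four_functions (T : finType) (a b c d : {set T} -> nat) :
  (forall A B, a A * b B <= c (A :|: B) * d (A :&: B)) ->
  (\sum_A a A) * (\sum_A b A) <= (\sum_A c A) * (\sum_A d A).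
Proof.
suff H (s : seq T) : uniq s -> forall a b c d : {set T} -> nat,
    (forall A B : {set T}, A \subset [set x in s] -> B \subset [set x in s] ->
      a A * b B <= c (A :|: B) * d (A :&: B)) ->
    (\sum_(A : {set T} | A \subset [set x in s]) a A) *
    (\sum_(A : {set T} | A \subset [set x in s]) b A) <=
    (\sum_(A : {set T} | A \subset [set x in s]) c A) *
    (\sum_(A : {set T} | A \subset [set x in s]) d A).
  move=> abcd; have := H _ (enum_uniq T) a b c d (fun A B _ _ => abcd A B).
  have sT (A : {set T}) : A \subset [set x in enum T].
    by apply/subsetP => x; rewrite inE mem_enum.
  by rewrite !(eq_bigl predT).
elim: s => [_|x s IH /= /andP[xs us]] {}a {}b {}c {}d abcd.
  have E (f : {set T} -> nat) :
      \sum_(A : {set T} | A \subset [set x in [::]]) f A = f set0.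
    have e : [set x in [::]] = set0 :> {set T} by apply/setP => y; rewrite !inE.
    by rewrite e (big_pred1 set0) // => A; rewrite subset0.
  by rewrite !E; have := abcd set0 set0; rewrite setU0 setI0; apply; exact: sub0set.
have e : [set y in x :: s] = x |: [set y in s] by apply/setP=> y; rewrite !inE.
rewrite e in abcd *; rewrite !big_subset_setU1 ?inE //.
apply: IH => // A B sA sB.
have xA : x \notin A by apply: contra xs => /(subsetP sA); rewrite inE.
have xB : x \notin B by apply: contra xs => /(subsetP sB); rewrite inE.
have sA' : A \subset x |: [set y in s] by apply: subset_trans sA (subsetUr _ _).
have sB' : B \subset x |: [set y in s] by apply: subset_trans sB (subsetUr _ _).
have sxA : x |: A \subset x |: [set y in s] by rewrite setUS.
have sxB : x |: B \subset x |: [set y in s] by rewrite setUS.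
have IA : A :&: (x |: B) = A :&: B.
  by apply/setP=> y; rewrite !inE; case: eqP => // ->; rewrite (negPf xA) (negPf xB).
have IB : (x |: A) :&: B = A :&: B.
  by apply/setP=> y; rewrite !inE; case: eqP => // ->; rewrite (negPf xA) (negPf xB).
apply: four_numbers.
- exact: abcd.
- by have := abcd _ _ sA' sxB; rewrite setUCA IA.
- by have := abcd _ _ sxA sB'; rewrite -setUA IB.
- by have := abcd _ _ sxA sxB; rewrite -setUUr -setUIr.
Qed.

Lemma card_sum_ind (T : finType) (F : {pred T}) : #|F| = \sum_A (A \in F : nat).
Proof. by rewrite -sum1_card big_mkcond. Qed.

(** * Pairs of downsets with given intersection and union *)

Section Fiber.

Variables (disp : Order.disp_t) (P : finPOrderType disp).
Implicit Types (A B I U : {set P}) (x y z : P).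

Lemma downsetP A :
  reflect (forall x y, x \in A -> (y <= x)%O -> y \in A) (is_downset A).
Proof.
apply: (iffP forallP) => [dA x y xA yx | dA x].
  by move/(_ x)/implyP/(_ xA)/forallP/(_ y)/implyP: dA; apply.
by apply/implyP => xA; apply/forallP => y; apply/implyP; apply: dA.
Qed.

Lemma downsetU A B : is_downset A -> is_downset B -> is_downset (A :|: B).
Proof.
move=> /downsetP dA /downsetP dB; apply/downsetP => x y; rewrite !inE.
by case/orP => [/dA h /h -> | /dB h /h ->]; rewrite ?orbT.
Qed.

Lemma downsetI A B : is_downset A -> is_downset B -> is_downset (A :&: B).
Proof.
move=> /downsetP dA /downsetP dB; apply/downsetP => x y; rewrite !inE.
by case/andP => /dA hA /dB hB le; rewrite hA ?hB.
Qed.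

Definition compl I U A := I :|: (U :\: A).

Definition fiber I U : {set {set P}} :=
  [set A | [&& is_downset A, is_downset (compl I U A), I \subset A & A \subset U]].

Section FixedFiber.

Variables I U : {set P}.
Let c := compl I U.

Lemma fiberP A :
  reflect [/\ is_downset A, is_downset (c A), I \subset A & A \subset U] (A \in fiber I U).
Proof. by rewrite inE; apply: and4P. Qed.

Lemma fiber_mem A z : A \in fiber I U -> ((z \in I) ==> (z \in A)) && ((z \in A) ==> (z \in U)).
Proof.
case/fiberP=> _ _ /subsetP/(_ z) IA /subsetP/(_ z) AU.
by apply/andP; split; apply/implyP.
Qed.

Lemma in_compl A z : (z \in c A) = (z \in I) || (z \in U) && (z \notin A).
Proof. by rewrite !inE andbC. Qed.

Lemma complK A : A \in fiber I U -> c (c A) = A.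
Proof.
move=> fA; apply/setP => z; rewrite !in_compl; have := fiber_mem z fA.
by case: (z \in I) (z \in A) (z \in U) => [] [] [].
Qed.

Lemma fiber_compl A : A \in fiber I U -> c A \in fiber I U.
Proof.
move=> fA; apply/fiberP; split; last 1 first.
- apply/subsetP => z; rewrite in_compl; have := fiber_mem z fA.
  by case: (z \in I) (z \in A) (z \in U) => [] [] [].
- by case/fiberP: fA.
- by rewrite complK //; case/fiberP: fA.
- by apply/subsetP => z zI; rewrite in_compl zI.
Qed.

Lemma complU A B : c (A :|: B) = c A :&: c B.
Proof.
apply/setP => z; rewrite in_setI !in_compl in_setU.
by case: (z \in I) (z \in A) (z \in B) (z \in U) => [] [] [] [].
Qed.

Lemma complI A B : c (A :&: B) = c A :|: c B.
Proof.
apply/setP => z; rewrite in_setU !in_compl in_setI.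
by case: (z \in I) (z \in A) (z \in B) (z \in U) => [] [] [] [].
Qed.

Lemma fiberU A B : A \in fiber I U -> B \in fiber I U -> A :|: B \in fiber I U.
Proof.
move=> /fiberP[dA dcA IA AU] /fiberP[dB dcB IB BU]; apply/fiberP.
split; first exact: downsetU.
- by rewrite -/c complU; apply: downsetI.
- exact: subset_trans IA (subsetUl _ _).
- by rewrite subUset AU.
Qed.

Lemma fiberI A B : A \in fiber I U -> B \in fiber I U -> A :&: B \in fiber I U.
Proof.
move=> /fiberP[dA dcA IA AU] /fiberP[dB dcB IB BU]; apply/fiberP.
split; first exact: downsetI.
- by rewrite -/c complI; apply: downsetU.
- by rewrite subsetI IA.
- exact: subset_trans (subsetIl _ _) AU.
Qed.

Lemma compl_sub A B : A \subset B -> c B \subset c A.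
Proof.
move=> /subsetP AB; apply/subsetP => z; rewrite !in_compl.
by case/orP => [->//|/andP[-> zB]]; rewrite (contra (AB z)) ?orbT.
Qed.

(** Complementation is injective on the fiber and maps [X] to a subset of the fiber disjoint from
    it. *)
Lemma card_half (X : {set {set P}}) :
  X \subset fiber I U -> (forall A, A \in X -> c A \notin X) ->
  2 * #|X| <= #|fiber I U|.
Proof.
move=> /subsetP XF Xc; have cX : #|c @: X| = #|X|.
  by apply: card_in_imset => A B /XF fA /XF fB e; rewrite -(complK fA) e complK.
have dis : [disjoint X & c @: X].
  rewrite disjoint_subset; apply/subsetP => A XA; rewrite !inE.
  by apply/imsetP => -[B XB e]; have := Xc B XB; rewrite -e XA.
rewrite mul2n -addnn -{2}cX -cardsUI.
have -> : #|X :&: c @: X| = 0.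
  by apply/eqP; rewrite cards_eq0 setI_eq0.
rewrite addn0; apply: subset_leq_card; rewrite subUset; apply/andP; split; first exact/subsetP.
by apply/subsetP => _ /imsetP[A /XF fA ->]; apply: fiber_compl.
Qed.

(* Kleitman's lemma in the Boolean lattice [fiber I U]: the up-closure of an  *)
(* intersecting family and the down-closure of a co-intersecting family have  *)
(* density at most 1/2 each, and they are negatively correlated.              *)
Lemma card_quarter (X : {set {set P}}) :
  X \subset fiber I U ->
  (forall A B, A \in X -> B \in X -> ~~ (A \subset c B)) ->
  (forall A B, A \in X -> B \in X -> ~~ (c A \subset B)) ->
  4 * #|X| <= #|fiber I U|.
Proof.
move=> XF Xi Xu; have XF' := subsetP XF.
pose up := [set A in fiber I U | [exists S in X, S \subset A]].
pose dn := [set A in fiber I U | [exists S in X, A \subset S]].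
have up2 : 2 * #|up| <= #|fiber I U|.
  apply: card_half; first by apply/subsetP => A; rewrite inE => /andP[].
  move=> A; rewrite inE => /andP[fA /exists_inP[S XS SA]].
  rewrite inE negb_and; apply/orP; right; apply/exists_inP => -[T XT TA].
  have := Xi _ _ XS XT; apply/negP/negPn; apply: subset_trans SA _.
  by rewrite -(complK fA); apply: compl_sub.
have dn2 : 2 * #|dn| <= #|fiber I U|.
  apply: card_half; first by apply/subsetP => A; rewrite inE => /andP[].
  move=> A; rewrite inE => /andP[fA /exists_inP[S XS SA]].
  rewrite inE negb_and; apply/orP; right; apply/exists_inP => -[T XT TA].
  have := Xu _ _ XS XT; apply/negP/negPn; apply: subset_trans TA.
  exact: compl_sub.
have Xud : #|X| <= #|up :&: dn|.
  apply: subset_leq_card; apply/subsetP => A XA; rewrite !inE -/(fiber I U).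
  have := XF' _ XA; rewrite inE => -> /=.
  by apply/andP; split; apply/exists_inP; exists A.
(* The four functions are the indicators of [up :&: dn], the fiber, [up] and [dn]: a union with A
   stays in [up], an intersection with A in [dn]. *)
have key : #|up :&: dn| * #|fiber I U| <= #|up| * #|dn|.
  rewrite !card_sum_ind; apply: four_functions => A B.
  case: (boolP (A \in up :&: dn)) => // /setIP[].
  rewrite inE => /andP[fA /exists_inP[S XS SA]]; rewrite inE => /andP[_ /exists_inP[T XT AT]].
  case: (boolP (B \in fiber I U)) => // fB.
  have -> : A :|: B \in up.
    rewrite inE fiberU //; apply/exists_inP; exists S => //.
    exact: subset_trans SA (subsetUl _ _).
  have -> // : A :&: B \in dn.
  rewrite inE fiberI //; apply/exists_inP; exists T => //.
  exact: subset_trans (subsetIl _ _) AT.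
case: (posnP #|fiber I U|) => [f0 | f0].
  by have := subset_leq_card XF; rewrite f0 leqn0 => /eqP->.
rewrite -(leq_pmul2r f0).
have := leq_mul up2 dn2; have := leq_mul Xud (leqnn #|fiber I U|).
by move: key; lia.
Qed.

End FixedFiber.
End Fiber.

Arguments fiberP {disp P I U A}.

(** * Separated pairs bound the distance of linear extensions *)

Section Separation.

Variables (disp : Order.disp_t) (P : finPOrderType disp) (pos : P -> nat).
Hypothesis pos_inj : injective pos.

Definition left_of (x y : P) : bool :=
  [&& ~~ (x <= y)%O, ~~ (y <= x)%O & pos x < pos y].

Hypothesis left_of_trans : transitive left_of.

Definition separated (A B : {set P}) : bool :=
  [exists x in A :\: B, exists y in B :\: A,
    [forall z in (A :\: B) :|: (B :\: A), pos x <= pos z <= pos y]].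

Section FixedFiber.

Variables I U : {set P}.
Let c := compl I U.

(** The map is symmetric difference with [E] in the Boolean lattice [fiber I U], hence a
    translation. *)
Lemma xor_compl_inj (E : {set P}) : E \in fiber I U ->
  {in fiber I U &, injective (fun A => (A :&: c E) :|: (c A :&: E))}.
Proof.
move=> fE A B fA fB /setP e; apply/setP => z; move: (e z).
rewrite !(in_compl, in_setU, in_setI).
have := fiber_mem z fE; have := fiber_mem z fA; have := fiber_mem z fB.
by case: (z \in I) (z \in A) (z \in B) (z \in E) (z \in U) => [] [] [] [] [].
Qed.

Lemma left_right (A : {set P}) u v : A \in fiber I U ->
  u \in A -> u \notin I -> v \in U -> v \notin A -> left_of u v || left_of v u.
Proof.
move=> fA uA uI vU vA; have [/downsetP dA /downsetP dcA _ _] := fiberP fA.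
have uv : ~~ (u <= v)%O.
  apply/negP => le; have := dcA v u; rewrite !in_compl vU vA (negPf uI) uA andbF orbT.
  by move/(_ isT le).
have vu : ~~ (v <= u)%O by apply: contra vA; apply: dA.
rewrite /left_of uv vu /= -neq_ltn; apply: contra vA => /eqP/pos_inj <- //.
Qed.

Lemma left_of_incomp x y : left_of x y -> ~~ (x <= y)%O /\ ~~ (y <= x)%O.
Proof. by case/and3P. Qed.

(** The elements of A outside I are incomparable to [w], hence left or right of it. By transitivity
    of [left_of] no element of the left part is comparable to one of the right part, so I together
    with the left part is in the fiber; the positions put [mn] in it and [mx] outside. *)
Lemma split_fiber (A : {set P}) mn mx w : A \in fiber I U ->
  mn \in A -> mx \in A -> mn \notin I -> mx \notin I -> w \in U -> w \notin A ->
  pos mn <= pos w <= pos mx ->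
  exists2 E : {set P}, E \in fiber I U & (mn \in E) && (mx \notin E).
Proof.
move=> fA mnA mxA mnI mxI wU wA /andP[mn_w w_mx].
have [/downsetP dA /downsetP dcA /subsetP IA /subsetP AU] := fiberP fA.
have lft u : u \in A -> u \notin I -> left_of u w || left_of w u.
  by move=> uA uI; apply: left_right fA _ _ _ _.
have asym u : left_of u w -> ~~ left_of w u.
  by rewrite /left_of => /and3P[_ _ lt]; rewrite [_ < pos u]ltnNge ltnW ?andbF.
pose E := I :|: [set z in A | left_of z w].
have inE' z : (z \in E) = (z \in I) || (z \in A) && left_of z w by rewrite !inE.
exists E; last first.
  rewrite !inE' (negPf mnI) (negPf mxI) mnA mxA /=.
  rewrite [left_of mx w]/left_of [pos mx < _]ltnNge w_mx !andbF andbT.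
  have /orP[//|] := lft _ mnA mnI.
  by rewrite /left_of [pos w < _]ltnNge mn_w !andbF.
have dI z u : z \in I -> (u <= z)%O -> u \in I.
  move=> zI le; have := dcA z u; rewrite !in_compl zI => /(_ isT le).
  by rewrite (dA z) ?IA // andbF orbF.
apply/fiberP; split.
- apply/downsetP => z u; rewrite !inE' => /orP[zI le|/andP[zA zw] le].
    by rewrite (dI z).
  have uA := dA _ _ zA le; rewrite uA.
  case: (boolP (u \in I)) => //= uI; have /orP[//|wu] := lft _ uA uI.
  by have [_ /negP] := left_of_incomp (left_of_trans zw wu).
- apply/downsetP => z u; rewrite !in_compl => /orP[zI le|/andP[zU zE] le].
    by rewrite (dI z).
  have uU : u \in U.
    case: (boolP (z \in A)) => zA; first by apply: AU; apply: dA le.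
    have := dcA z u; rewrite !in_compl zU zA orbT => /(_ isT le).
    by case/orP => [/IA/AU|/andP[]].
  rewrite uU /=; case: (boolP (u \in I)) => //= uI.
  rewrite inE' (negPf uI) /= negb_and -implybE; apply/implyP => uA; apply/negP => uw.
  move: zE; rewrite inE' negb_or negb_and => /andP[zI]; case: (boolP (z \in A)) => /= zA zw.
    have := lft _ zA zI; rewrite (negPf zw) /= => wz.
    by have [/negP] := left_of_incomp (left_of_trans uw wz).
  have := dcA z u; rewrite !in_compl zU zA orbT => /(_ isT le).
  by rewrite uA (negPf uI) andbF.
- by apply/subsetP => z zI; rewrite inE' zI.
- by apply/subsetP => z; rewrite inE' => /orP[/IA/AU|/andP[/AU]].
Qed.

Lemma leq_card_fiber (p q : pred {set P}) (f : {set P} -> {set P}) :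
  {in fiber I U &, injective f} ->
  (forall A, A \in fiber I U -> p A -> (f A \in fiber I U) && q (f A)) ->
  #|[set A in fiber I U | p A]| <= #|[set A in fiber I U | q A]|.
Proof.
move=> f_inj pq; rewrite -(@card_in_imset _ _ f); last first.
  by move=> A B /setIdP[fA _] /setIdP[fB _]; apply: f_inj.
apply: subset_leq_card; apply/subsetP => _ /imsetP[A + ->].
by rewrite in_set => /andP[fA pA]; rewrite in_set; apply: pq.
Qed.

(** A member of a nonempty [X], complemented or cut by [split_fiber] if necessary, gives an [E]
    containing the leftmost element [mn] of U minus I but not the rightmost one [mx].
    Complementation and translation by [E] show that, of the four classes given by membership of
    [mn] and [mx], the one like [E] is the largest. So it is at least a quarter of the fiber, and
    its members are separated. *)
Lemma card_fiber_le (X : {set {set P}}) :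
  X \subset fiber I U ->
  (forall A B, A \in X -> B \in X -> ~~ (A \subset c B)) ->
  (forall A B, A \in X -> B \in X -> ~~ (c A \subset B)) ->
  #|X| <= #|[set A in fiber I U | separated A (c A)]|.
Proof.
move=> XF Xi Xu; case: (set_0Vmem X) => [->|[A XA]]; first by rewrite cards0.
have fA := subsetP XF _ XA; have [_ _ /subsetP IA /subsetP AU] := fiberP fA.
have /subsetPn[a aA] := Xi _ _ XA XA; rewrite in_compl negb_or => /andP[aI _].
have /subsetPn[w] := Xu _ _ XA XA; rewrite in_compl => /orP[/IA->//|/andP[wU wA] _].
pose D := U :\: I; have aD : a \in D by rewrite inE aI AU.
have wD : w \in D by rewrite inE wU (contra (IA w)).
pose mn := [arg min_(z < a in D) pos z]; pose mx := [arg max_(z > a in D) pos z].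
have [mnD mnP] : mn \in D /\ forall z, z \in D -> pos mn <= pos z.
  by rewrite /mn; case: arg_minnP.
have [mxD mxP] : mx \in D /\ forall z, z \in D -> pos z <= pos mx.
  by rewrite /mx; case: arg_maxnP.
have [mnU mnI] : mn \in U /\ mn \notin I by move: mnD; rewrite inE => /andP[].
have [mxU mxI] : mx \in U /\ mx \notin I by move: mxD; rewrite inE => /andP[].
have [E fE /andP[mnE mxE]] :
    exists2 E : {set P}, E \in fiber I U & (mn \in E) && (mx \notin E).
  case: (boolP (mn \in A)) => mnA; case: (boolP (mx \in A)) => mxA.
  - by apply: split_fiber fA _ _ _ _ wU wA _ => //; rewrite mnP // mxP.
  - by exists A => //; rewrite mnA mxA.
  - exists (c A); first exact: fiber_compl.
    by rewrite !in_compl mnU mnA mxU mxA (negPf mxI) orbT.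
  - apply: (@split_fiber (c A) mn mx a); rewrite ?fiber_compl ?in_compl //.
    + by rewrite mnU mnA orbT.
    + by rewrite mxU mxA orbT.
    + exact: AU.
    + by rewrite aA (negPf aI) andbF.
    + by rewrite mnP // mxP.
pose F b b' := [set B in fiber I U | ((mn \in B) == b) && ((mx \in B) == b')].
have sepF : #|F true false| <= #|[set A in fiber I U | separated A (c A)]|.
  apply: subset_leq_card; apply/subsetP => B.
  rewrite /F in_set => /andP[fB /andP[/eqP mnB /eqP mxB]].
  rewrite in_set fB /=.
  apply/exists_inP; exists mn; first by rewrite in_setD in_compl mnB (negPf mnI) andbF.
  apply/exists_inP; exists mx; first by rewrite in_setD in_compl mxU mxB orbT.
  apply/forall_inP => z zD; have zUI : z \in D.
    move: zD; rewrite !(in_compl, in_setU, in_setD); have := fiber_mem z fB.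
    by case: (z \in I) (z \in B) (z \in U) => [] [] [].
  by rewrite mnP // mxP.
have F01 : #|F false true| <= #|F true false|.
  apply: (leq_card_fiber (f := c)).
    by move=> B B' fB fB' e; rewrite -(complK fB) -/c e /c complK.
  move=> B fB /andP[/eqP h1 /eqP h2]; rewrite fiber_compl //= !in_compl mnU mxU h1 h2.
  by rewrite (negPf mxI) orbT.
have F11 : #|F true true| <= #|F false false|.
  apply: (leq_card_fiber (f := c)).
    by move=> B B' fB fB' e; rewrite -(complK fB) -/c e /c complK.
  move=> B fB /andP[/eqP h1 /eqP h2]; rewrite fiber_compl //= !in_compl mnU mxU h1 h2.
  by rewrite (negPf mxI) (negPf mnI).
have F00 : #|F false false| <= #|F true false|.
  apply: leq_card_fiber (xor_compl_inj fE) _ => B fB /andP[/eqP h1 /eqP h2].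
  rewrite fiberU ?fiberI ?fiber_compl //= !(in_compl, in_setU, in_setI) mnU mxU h1 h2.
  by rewrite (negPf mxI) (negPf mnI) mnE (negPf mxE).
have cardF : #|fiber I U| = #|F true true| + #|F true false| + (#|F false true| + #|F false false|).
  have split2 (Y : {set {set P}}) (p : pred {set P}) :
      #|Y| = #|[set B in Y | p B == true]| + #|[set B in Y | p B == false]|.
    rewrite -(cardsID [set B | p B]) -!setIdE; congr (_ + _).
      by apply: eq_card => B; rewrite !inE eqb_id.
    by apply: eq_card => B; rewrite !inE eqbF_neg andbC.
  rewrite /F; move: (fiber I U) => G; rewrite (split2 G (fun B => mn \in B)).
  rewrite (split2 [set B in G | (mn \in B) == true] (fun B => mx \in B)).
  rewrite (split2 [set B in G | (mn \in B) == false] (fun B => mx \in B)).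
  by congr (_ + _ + (_ + _)); apply: eq_card => B; rewrite !in_set -andbA.
rewrite -(@leq_pmul2l 4) //; apply: leq_trans (card_quarter XF Xi Xu) _.
rewrite cardF -[4]/(2 + 2) mulnDl !mul2n -!addnn.
have F10 := leq_trans F00 sepF.
by rewrite !leq_add // ?(leq_trans F01) ?(leq_trans F11).
Qed.

End FixedFiber.

Lemma linext_distanceE (d : Order.disp_t) (T : finPOrderType d) (L1 L2 : rel T) :
  antisymmetric L1 ->
  linext_distance L1 L2 =
    #|[set p : T * T | [&& p.1 != p.2, L1 p.1 p.2 & L2 p.2 p.1]]|.
Proof.
move=> anti; rewrite -(@card_in_imset _ _ (fun p : T * T => [set p.1; p.2])).
  apply: eq_card => D; rewrite inE; apply/existsP/imsetP => [[x /existsP[y]]|].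
    by case/and4P=> xy /eqP-> l1 l2; exists (x, y) => //; rewrite inE /= xy l1.
  case=> -[x y]; rewrite inE /= => /and3P[xy l1 l2] ->.
  by exists x; apply/existsP; exists y; rewrite xy eqxx l1.
move=> [x y] [x' y']; rewrite !inE /= => /and3P[xy l _] /and3P[xy' l' _] /setP e.
have := e x; have := e y; rewrite !inE !eqxx orbT /= => /esym/orP[]/eqP ey /esym/orP[]/eqP ex.
- by rewrite ex ey eqxx in xy.
- by move: xy; rewrite (anti x y) ?eqxx // l; rewrite ex ey l'.
- by rewrite ex ey.
- by rewrite ex ey eqxx in xy.
Qed.

Lemma card_by_fibers (Y : {set {set P} * {set P}}) :
  #|Y| = \sum_(q : {set P} * {set P})
    #|[set A : {set P} | [&& (A, compl q.1 q.2 A) \in Y, q.1 \subset A & A \subset q.2]]|.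
Proof.
rewrite -sum1_card (partition_big (fun p : {set P} * {set P} => (p.1 :&: p.2, p.1 :|: p.2))
  predT) //=.
apply: eq_bigr => -[I U] _ /=; rewrite sum1dep_card.
rewrite -[RHS](@card_in_imset _ _ (fun A => (A, compl I U A))); last by move=> A B _ _ [].
apply: eq_card => -[A B]; rewrite inE /=; apply/andP/imsetP => [[ABY /eqP[<- <-]]|].
  have e : compl (A :&: B) (A :|: B) A = B.
    by apply/setP => z; rewrite !inE; case: (z \in A) (z \in B) => [] [].
  by exists A; rewrite ?inE e ?ABY ?subsetIl ?subsetUl.
case=> C; rewrite inE => /and3P[CY /subsetP IC /subsetP CU] [-> ->]; split => //.
apply/eqP; congr (_, _); apply/setP => z; rewrite !inE; have /implyP := IC z; have /implyP := CU z;
  by case: (z \in C) (z \in I) (z \in U) => [] [] [].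
Qed.

Definition separated_pairs : {set {set P} * {set P}} :=
  [set p | [&& is_downset p.1, is_downset p.2 & separated p.1 p.2]].

(** In a fiber, [X] consists of the A before their complement cA in [L1] and after it in [L2]. If A
    were contained in cB, then B in cA, and A, cB, B, cA would be increasing in [L2], a
    contradiction; dually for [L1]. *)
Lemma linext_distance_le (L1 L2 : rel (downset P)) :
  linear_extension L1 -> linear_extension L2 ->
  linext_distance L1 L2 <= #|separated_pairs|.
Proof.
move=> [_ anti1 tr1 ext1] [_ anti2 tr2 ext2]; rewrite linext_distanceE //.
set R := [set p | _]; pose f (p : downset P * downset P) := (val p.1, val p.2).
have f_inj : injective f by move=> [a b] [a' b'] [/val_inj-> /val_inj->].
rewrite -(card_imset (mem R) f_inj) (card_by_fibers separated_pairs) card_by_fibers.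
apply: leq_sum => -[I U] _ /=; set X := [set A | _].
have XP A : A \in X -> exists a b : downset P,
    [/\ val a = A, val b = compl I U A, a != b, L1 a b & L2 b a].
  rewrite inE => /and3P[/imsetP[[a b]] + [/= ea eb] IA AU].
  by rewrite inE /= => /and3P[ab l1 l2]; exists a, b; split.
have fX A : A \in X -> A \in fiber I U.
  move=> XA; have [a [b [ea eb _ _ _]]] := XP _ XA.
  move: XA; rewrite inE => /and3P[_ IA AU]; apply/fiberP; split => //.
    by rewrite -ea (valP a).
  by rewrite -eb (valP b).
apply: (leq_trans (@card_fiber_le I U X _ _ _)).
- exact/subsetP.
- move=> A B XA XB; apply/negP => AcB.
  have BcA : B \subset compl I U A by rewrite -(complK (fX _ XB)); apply: compl_sub.
  have [a [ca [ea eca nea l1a l2a]]] := XP _ XA.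
  have [b [cb [eb ecb neb l1b l2b]]] := XP _ XB.
  have l1 : L2 a cb by apply: ext2; rewrite /Order.le /= /downset_le [downset_val a]ea
    [downset_val cb]ecb.
  have l2 : L2 b ca by apply: ext2; rewrite /Order.le /= /downset_le [downset_val b]eb
    [downset_val ca]eca.
  have l3 : L2 a ca := tr2 _ _ _ l1 (tr2 _ _ _ l2b l2).
  by move: nea; rewrite (anti2 a ca) ?eqxx // l3 l2a.
- move=> A B XA XB; apply/negP => cAB.
  have cBA : compl I U B \subset A by rewrite -(complK (fX _ XA)); apply: compl_sub.
  have [a [ca [ea eca nea l1a l2a]]] := XP _ XA.
  have [b [cb [eb ecb neb l1b l2b]]] := XP _ XB.
  have l1 : L1 ca b by apply: ext1; rewrite /Order.le /= /downset_le [downset_val ca]eca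
    [downset_val b]eb.
  have l2 : L1 cb a by apply: ext1; rewrite /Order.le /= /downset_le [downset_val cb]ecb
    [downset_val a]ea.
  have l3 : L1 ca a := tr1 _ _ _ l1 (tr1 _ _ _ l1b l2).
  by move: nea; rewrite (anti1 a ca) ?eqxx // l1a l3.
- apply: subset_leq_card; apply/subsetP => A /setIdP[fA sep].
  by rewrite !inE /= sep; case/fiberP: fA => -> -> -> ->.
Qed.

End Separation.

(** * Lexicographic orders as binary weights *)

Section BinaryWeight.

Variables (T : finType) (w : T -> nat).
Hypothesis w_inj : injective w.

(** Comparing binary numbers compares sets by the greatest element of their symmetric difference,
    and the properties of a linear order are inherited from the natural numbers. *)
Definition weight (A : {set T}) := \sum_(z in A) 2 ^ w z.

Lemma weight_lt_expn (A : {set T}) m : (forall z, z \in A -> w z < m) -> weight A < 2 ^ m.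
Proof.
elim: m A => [|m IH] A ltA.
  rewrite /weight big_pred0 ?expn0 // => z; apply/negP => /ltA; by rewrite ltn0.
have split_m : weight (A :\: [set z | w z == m]) < 2 ^ m.
  apply: IH => z; rewrite !inE => /andP[zm /ltA]; by rewrite ltnS leq_eqVlt (negPf zm).
rewrite /weight (big_setID [set z | w z == m]) /= -/(weight _) expnS mul2n -addnn -addnS leq_add //.
case: (set_0Vmem (A :&: [set z | w z == m])) => [->|[z]]; rewrite /weight;
  first by rewrite big_set0.
rewrite !inE => /andP[zA /eqP zm]; rewrite (big_pred1 z) ?zm // => u.
rewrite !inE; apply/andP/eqP => [[_ /eqP um]|->]; last by rewrite zA zm.
by apply: w_inj; rewrite um zm.
Qed.

Lemma weight_lt (A B : {set T}) x :
  x \in B :\: A -> (forall z, z \in A :\: B -> w z <= w x) -> weight A < weight B.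
Proof.
move=> xBA ltx; rewrite /weight (big_setID B) /= [ltnRHS](big_setID A) /= setIC ltn_add2l.
apply: leq_trans (_ : 2 ^ w x <= _); last by rewrite (bigD1 x) //= leq_addr.
apply: weight_lt_expn => z zAB; rewrite ltn_neqAle ltx // andbT.
apply: contraTN zAB => /eqP/w_inj->; move: xBA; rewrite !inE => /andP[/negPf-> _].
by rewrite andbF.
Qed.

Lemma weight_sub (A B : {set T}) : A \subset B -> weight A <= weight B.
Proof.
move=> sAB; rewrite /weight [leqRHS](big_setID A) /=.
by rewrite (setIidPr sAB) leq_addr.
Qed.

Lemma top_diff (A B : {set T}) : A != B ->
  exists2 x, x \in (A :\: B) :|: (B :\: A)
    & forall z, z \in (A :\: B) :|: (B :\: A) -> w z <= w x.
Proof.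
move=> AB; case: (set_0Vmem ((A :\: B) :|: (B :\: A))) => [/eqP|[x0 x0D]].
  by rewrite setU_eq0 !setD_eq0 -eqEsubset (negPf AB).
by case: (arg_maxnP w x0D) => x xD mx; exists x.
Qed.

Lemma weight_inj : injective weight.
Proof.
move=> A B; apply: contra_eq => AB; have [x xD mx] := top_diff AB.
rewrite neq_ltn; move: (xD); rewrite in_setU => /orP[xAB|xBA]; apply/orP.
  by right; apply: (weight_lt xAB) => z zBA; apply: mx; rewrite in_setU zBA orbT.
by left; apply: (weight_lt xBA) => z zAB; apply: mx; rewrite in_setU zAB.
Qed.

Lemma weight_le_top (A B : {set T}) x : weight A <= weight B ->
  x \in (A :\: B) :|: (B :\: A) ->
  (forall z, z \in (A :\: B) :|: (B :\: A) -> w z <= w x) -> x \in B :\: A.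
Proof.
move=> le; rewrite in_setU => /orP[xAB mx|//].
suff : weight B < weight A by rewrite ltnNge le.
by apply: (weight_lt xAB) => z zBA; apply: mx; rewrite in_setU zBA orbT.
Qed.

End BinaryWeight.

Lemma weight_linext (disp : Order.disp_t) (P : finPOrderType disp) (w : P -> nat) :
  injective w ->
  linear_extension (fun A B : downset P => weight w A <= weight w B).
Proof.
move=> w_inj; split.
- by move=> A B; apply: leq_total.
- by move=> A B le; apply/val_inj/(weight_inj w_inj)/anti_leq.
- by move=> B A C; apply: leq_trans.
- by move=> A B AB; apply: weight_sub.
Qed.

Lemma linext_diameter_downset (disp : Order.disp_t) (P : finPOrderType disp) (pos : P -> nat) :
  injective pos -> transitive (left_of pos) ->
  is_linext_diameter (downset P) #|separated_pairs pos|.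
Proof.
move=> pos_inj lft_tr; split; last by move=> L1 L2; apply: linext_distance_le.
(* [rev] reverses the positions, so its weights compare by the least element of the symmetric
   difference. *)
pose N := \max_z pos z; pose rev z := N - pos z.
have leN z : pos z <= N by apply: leq_bigmax.
have rev_inj : injective rev by move=> x y e; apply: pos_inj; have := leN x; have := leN y;
  rewrite /rev in e; lia.
have le_rev x y : (rev x <= rev y) = (pos y <= pos x).
  by have := leN x; have := leN y; rewrite /rev; lia.
have [l1 l2] := (weight_linext pos_inj, weight_linext rev_inj).
exists (fun A B : downset P => weight pos A <= weight pos B).
exists (fun A B : downset P => weight rev A <= weight rev B); split => //.
rewrite linext_distanceE; last by case: l1.
pose f (p : downset P * downset P) := (val p.1, val p.2).
have f_inj : injective f by move=> [a b] [a' b'] [/val_inj-> /val_inj->].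
rewrite -(card_imset _ f_inj); apply: eq_card => -[A B]; rewrite inE /=.
apply/imsetP/and3P => [[[a b]] + [-> ->]|[dA dB]].
  rewrite inE /= => /and3P[ab le1 le2]; split; [exact: (valP a) | exact: (valP b) |].
  have {}ab : val a != val b by apply: contra ab => /eqP/val_inj->.
  have [y yD my] := top_diff pos ab; have [x xD mx] := top_diff rev ab.
  apply/exists_inP; exists x.
    by apply: (weight_le_top rev_inj le2); rewrite setUC // => z /mx.
  apply/exists_inP; exists y; first exact: (weight_le_top pos_inj le1).
  by apply/forall_inP => z zD; rewrite my // -le_rev mx.
case/exists_inP => x xAB /exists_inP[y yBA /forall_inP bnd].
exists (Downset dA, Downset dB) => //; rewrite inE /=; apply/and3P; split.
- by apply: contraTN xAB => /eqP[->]; rewrite setDv inE.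
- apply/ltnW/(weight_lt pos_inj yBA) => z zAB.
  by have := bnd z; rewrite in_setU zAB => /(_ isT)/andP[].
- apply/ltnW/(weight_lt rev_inj xAB) => z zBA.
  by rewrite le_rev; have := bnd z; rewrite in_setU zBA orbT => /(_ isT)/andP[].
Qed.

(** * The dynamic program counts separated pairs *)

Section ExtensionsCount.

Variables (disp : Order.disp_t) (P : finPOrderType disp) (pos hgt : P -> nat).
Variables (n : nat) (H : nat -> nat).
Hypotheses (pos_inj : injective pos) (pos_lt : forall z, pos z < n).
Hypothesis pos_onto : forall k, k < n -> exists z, pos z = k.
Hypotheses (hgt_gt0 : forall z, 0 < hgt z) (HE : forall z, H (pos z) = hgt z).
Hypothesis leE : forall x y : P, (x <= y)%O = (pos x <= pos y) && (hgt x <= hgt y).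

Implicit Types (A B D : {set P}) (x y z : P).

Definition above k : {set P} := [set z | k <= pos z].
Definition symdiff A B : {set P} := (A :\: B) :|: (B :\: A).

(** As heights are positive, [a] is the greatest height in A, or 0 if A is empty. Closure is
    required only among decided elements. *)
Definition partial_downset k A a : Prop :=
  [/\ A \subset above k,
      forall x y, x \in A -> (y <= x)%O -> k <= pos y -> y \in A,
      forall z, z \in A -> hgt z <= a
    & 0 < a -> exists2 z, z \in A & hgt z = a].

Definition partial_flag A B f : Prop :=
  if f == 0 then A = B else
  exists x y, [/\ y \in B :\: A, x \in symdiff A B,
    forall z, z \in symdiff A B -> pos x <= pos z <= pos y & (f == 2) = (x \in A)].

Definition completions k A B : nat :=
  \sum_(p in separated_pairs pos) (p.1 :&: above k == A) * (p.2 :&: above k == B).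

Section Step.

Variables (k : nat) (z0 : P).
Hypothesis z0k : pos z0 = k.

Lemma above_step : above k = z0 |: above k.+1.
Proof.
by apply/setP => z; rewrite !inE leq_eqVlt -z0k eq_sym (inj_eq pos_inj).
Qed.

Lemma above_notin A : A \subset above k.+1 -> z0 \notin A.
Proof. by move=> /subsetP sA; apply/negP => /sA; rewrite inE z0k ltnn. Qed.

Lemma completions_step A B : A \subset above k.+1 -> B \subset above k.+1 ->
  completions k.+1 A B =
  completions k (z0 |: A) (z0 |: B) + completions k (z0 |: A) B +
  completions k A (z0 |: B) + completions k A B.
Proof.
have cut (C D : {set P}) : C \subset above k.+1 ->
    ((D :&: above k.+1 == C) : nat) = (D :&: above k == z0 |: C) + (D :&: above k == C).
  move=> sC; have zC := above_notin sC; rewrite above_step setIUr.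
  have zU : z0 \notin D :&: above k.+1 by rewrite !inE z0k ltnn andbF.
  case: (boolP (z0 \in D)) => zD.
    have -> : D :&: [set z0] = [set z0] by apply/setIidPr; rewrite sub1set.
    have -> : (z0 |: D :&: above k.+1 == C) = false.
      by apply/eqP => e; move: zC; rewrite -e setU11.
    rewrite addn0; congr nat_of_bool; apply/eqP/eqP => [->//|e].
    by rewrite -(setU1K zU) e setU1K.
  have -> : D :&: [set z0] = set0.
    by apply/setP => z; rewrite !inE; case: (z =P z0) => [->|]; rewrite ?(negPf zD) ?andbF.
  have -> : (set0 :|: D :&: above k.+1 == z0 |: C) = false.
    by apply/eqP => e; move: zU; rewrite -[_ :&: _]set0U e setU11.
  by rewrite set0U.
move=> sA sB; rewrite /completions -!big_split /=; apply: eq_bigr => p _.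
rewrite (cut A _ sA) (cut B _ sB) mulnDl !mulnDr -!addnA; congr (_ + _); rewrite !addnA;
  congr (_ + _).
Qed.

Lemma partial_in A a : partial_downset k.+1 A a ->
  partial_downset k (z0 |: A) (maxn a (hgt z0)).
Proof.
move=> [sA dA leA topA]; split.
- by rewrite above_step setUS.
- move=> x y; rewrite !inE => /orP[/eqP-> yz|xA yx] ky.
    by rewrite -(inj_eq pos_inj) eqn_leq z0k ky -z0k; move: yz; rewrite leE => /andP[->].
  case: eqP => //= nyz; apply: dA xA yx _; rewrite ltn_neqAle ky andbT.
  by apply/eqP => e; apply: nyz; apply: pos_inj; rewrite z0k e.
- by move=> z; rewrite !inE leq_max => /orP[/eqP->|/leA->]; rewrite ?leqnn ?orbT.
- move=> _; case: (leqP a (hgt z0)) => [le|lt]; first by exists z0; rewrite ?setU11.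
  have [|z zA e] := topA; first exact: leq_ltn_trans lt.
  by exists z => //; rewrite !inE zA orbT.
Qed.

Lemma partial_out A a : partial_downset k.+1 A a -> a < hgt z0 -> partial_downset k A a.
Proof.
move=> [sA dA leA topA] lt; split => //.
- by rewrite above_step; apply: subset_trans sA (subsetUr _ _).
- move=> x y xA yx ky; apply: (dA x) => //; rewrite ltn_neqAle ky andbT.
  apply/eqP => e; have ey : y = z0 by apply: pos_inj; rewrite z0k e.
  move: yx; rewrite ey leE => /andP[_ le].
  by have := leq_trans lt (leq_trans le (leA _ xA)); rewrite ltnn.
Qed.

(** [z0] comes before all of A in position, so [hgt z0 <= a] puts it below the element of height
    [a], and it belongs to every downset extending A. *)
Lemma partial_forced A a D : partial_downset k.+1 A a -> hgt z0 <= a -> is_downset D ->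
  (D :&: above k == A) = false.
Proof.
move=> [sA dA leA topA] le /downsetP dD; apply/eqP => e.
have [|z zA hz] := topA; first exact: leq_trans le.
have zD : z \in D by move: zA; rewrite -e inE => /andP[].
have : z0 \in D.
  apply: dD zD _; rewrite leE hz le andbT z0k.
  by have := subsetP sA z zA; rewrite inE => /ltnW.
by move/negP: (above_notin sA); rewrite -e !inE z0k leqnn andbT.
Qed.

End Step.

Lemma completions_forced_l k z0 A a B : pos z0 = k ->
  partial_downset k.+1 A a -> hgt z0 <= a -> completions k A B = 0.
Proof.
move=> z0k sA le; rewrite /completions big1 // => p; rewrite inE => /and3P[d1 _ _].
by rewrite (partial_forced z0k sA le d1).
Qed.

Lemma completions_forced_r k z0 A b B : pos z0 = k ->
  partial_downset k.+1 B b -> hgt z0 <= b -> completions k A B = 0.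
Proof.
move=> z0k sB le; rewrite /completions big1 // => p; rewrite inE => /and3P[_ d2 _].
by rewrite (partial_forced z0k sB le d2) muln0.
Qed.

(** Undecided elements have smaller positions, so [y] remains the topmost difference, and it is on
    the wrong side. *)
Lemma completions_dead k A B y : A \subset above k -> y \in A :\: B ->
  (forall z, z \in symdiff A B -> pos z <= pos y) -> completions k A B = 0.
Proof.
move=> sA yAB top; rewrite /completions big1 // => -[A' B'].
rewrite inE /= => /and3P[_ _ /exists_inP[x _ /exists_inP[y' y'BA /forall_inP bnd]]].
case: eqP => // eA; case: eqP => // eB; exfalso.
have ky : k <= pos y.
  by move: yAB; rewrite inE => /andP[_ /(subsetP sA)]; rewrite inE.
have yA'B' : y \in A' :\: B' by move: yAB; rewrite -eA -eB !inE ky !andbT.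
have /andP[_ le1] : pos x <= pos y <= pos y' by apply: bnd; rewrite in_setU yA'B'.
have ky' := leq_trans ky le1.
have le2 : pos y' <= pos y.
  by apply: top; move: y'BA; rewrite /symdiff -eA -eB !inE ky' !andbT => ->; rewrite orbT.
have e : y = y' by apply: pos_inj; apply/anti_leq; rewrite le1.
by move: y'BA yA'B'; rewrite -e !inE => /andP[/negP nA _] /andP[_ /nA].
Qed.

Lemma completionsE k A B a b f : k <= n -> f < 3 ->
  partial_downset k A a -> partial_downset k B b -> partial_flag A B f ->
  completions k A B = extensions H k a b f.
Proof.
elim: k A B a b f => [|k IH] A B a b f le_k lt_f pA pB pf /=.
  have U0 D : D :&: above 0 = D by apply/setIidPl/subsetP => z _; rewrite inE.
  have -> : completions 0 A B = ((A, B) \in separated_pairs pos).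
    rewrite /completions; case: (boolP ((A, B) \in _)) => AB.
      rewrite (bigD1 (A, B)) //= !U0 !eqxx big1 // => -[A' B'] /andP[_].
      by rewrite !U0 -[_ == _]/((_ == _) && (_ == _)) /= negb_and => /orP[]/negPf->; rewrite ?muln0.
    rewrite big1 // => -[A' B'] AB'; rewrite /= !U0; case: eqP => // e1; case: eqP => // e2.
    by rewrite e1 e2 (negPf AB) in AB'.
  congr nat_of_bool; rewrite inE /=.
  have -> : is_downset A by apply/downsetP => x y xA yx; case: pA => _ dA _ _; apply: dA yx _.
  have -> /= : is_downset B by apply/downsetP => x y xB yx; case: pB => _ dB _ _; apply: dB yx _.
  move: pf; rewrite /partial_flag; case: (f =P 0) => [-> <-|_ [x [y [yBA xD bnd ->]]]].
    by apply/exists_inP => -[x]; rewrite setDv inE.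
  apply/exists_inP/idP => [[x' x'AB /exists_inP[y' _ /forall_inP bnd']]|xA].
    have x'D : x' \in symdiff A B by rewrite in_setU x'AB.
    have /andP[le1 _] := bnd _ x'D; have /andP[le2 _] := bnd' _ xD.
    have -> : x = x' by apply: pos_inj; apply/anti_leq; rewrite le1.
    by move: x'AB; rewrite inE => /andP[].
  exists x; first by move: xD; rewrite !inE xA /= orbF.
  by apply/exists_inP; exists y => //; apply/forall_inP => z; apply: bnd.
have [z0 z0k] := pos_onto le_k; have le_k' := ltnW le_k.
have [sA sB] : A \subset above k.+1 /\ B \subset above k.+1 by case: pA; case: pB.
have [zA zB] := (above_notin z0k sA, above_notin z0k sB).
have posA z : z \in symdiff A B -> k < pos z.
  by rewrite !inE => /orP[/andP[_ /(subsetP sA)]|/andP[_ /(subsetP sB)]]; rewrite inE.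
rewrite (completions_step z0k) // -z0k HE z0k; congr (_ + _ + _ + _).
- have [pA' pB'] := (partial_in z0k pA, partial_in z0k pB); apply: IH => //; move: pf;
    rewrite /partial_flag.
  case: (f == 0) => [->//|[x [y [yBA xD bnd fx]]]]; exists x, y.
  have e1 : (z0 |: A) :\: (z0 |: B) = A :\: B.
    by apply/setP => z; rewrite !inE; case: (z =P z0) => [->|]; rewrite ?(negPf zA) ?andbF.
  have e2 : (z0 |: B) :\: (z0 |: A) = B :\: A.
    by apply/setP => z; rewrite !inE; case: (z =P z0) => [->|]; rewrite ?(negPf zB) ?andbF.
  rewrite /symdiff e1 e2; split => //; rewrite fx !inE; case: (x =P z0) => // xz.
  by have := posA x xD; rewrite xz z0k ltnn.
- case: (ltnP b (hgt z0)) => [lt|le]; last by rewrite (completions_forced_r _ z0k pB).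
  have zAB : z0 \in (z0 |: A) :\: B by rewrite !inE eqxx zB.
  have pA' := partial_in z0k pA; have pB' := partial_out z0k pB lt.
  have symE z : z \in symdiff (z0 |: A) B = (z == z0) || (z \in symdiff A B).
    by rewrite !inE; case: (z =P z0) => [->|]; rewrite ?(negPf zA) ?(negPf zB).
  (* From flag 0, [z0] would become the topmost difference and lie in A; this is the test [f != 0]
     of the recursion. *)
  case: (f =P 0) pf => [->|/eqP f0]; rewrite /partial_flag /=.
    move=> AB; apply: (completions_dead (y := z0)) => //; first by case: pA'.
    by move=> z; rewrite symE AB /symdiff setDv setU0 inE orbF => /eqP->.
  rewrite (negPf f0) => -[x [y [yBA xD bnd fx]]]; apply: IH => //; exists z0, y; split.
  - by move: yBA; rewrite !inE; case: (y =P z0) => [->|]; rewrite ?(negPf zB) ?andbF.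
  - by rewrite symE eqxx.
  - have yD : y \in symdiff A B by rewrite in_setU yBA orbT.
    move=> z; rewrite symE z0k => /orP[/eqP->|zD]; first by rewrite z0k leqnn ltnW ?posA.
    by rewrite ltnW ?posA //; have /andP[] := bnd z zD.
  - by rewrite setU11.
- case: (ltnP a (hgt z0)) => [lt|le]; last by rewrite (completions_forced_l _ z0k pA).
  have pA' := partial_out z0k pA lt; have pB' := partial_in z0k pB.
  have symE z : z \in symdiff A (z0 |: B) = (z == z0) || (z \in symdiff A B).
    by rewrite !inE; case: (z =P z0) => [->|]; rewrite ?(negPf zA) ?(negPf zB).
  apply: IH => //; move: pf; rewrite /partial_flag /=;
    case: (f =P 0) => [_ AB|_ [x [y [yBA xD bnd fx]]]].
    (* The first difference is both the topmost and the lowest one. *)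
    exists z0, z0; split; rewrite ?symE ?(negPf zA) ?eqxx //; first by rewrite !inE eqxx zA.
    by move=> z; rewrite symE AB /symdiff setDv setU0 inE orbF => /eqP->; rewrite leqnn.
  exists z0, y; split; rewrite ?symE ?(negPf zA) ?eqxx //.
    by move: yBA; rewrite !inE => /andP[-> ->]; rewrite orbT.
  have yD : y \in symdiff A B by rewrite in_setU yBA orbT.
  move=> z; rewrite symE z0k => /orP[/eqP->|zD]; first by rewrite z0k leqnn ltnW ?posA.
  by rewrite ltnW ?posA //; have /andP[] := bnd z zD.
- case: (ltnP a (hgt z0)) => [lt_a|le]; last by rewrite (completions_forced_l _ z0k pA).
  case: (ltnP b (hgt z0)) => [lt_b|le]; last by rewrite (completions_forced_r _ z0k pB).
  by apply: IH => //; apply: (partial_out z0k).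
Qed.

Lemma card_separated_pairs : #|separated_pairs pos| = extensions H n 0 0 0.
Proof.
have p0 : partial_downset n set0 0.
  by split => //; [exact: sub0set | move=> x y; rewrite inE | move=> z; rewrite inE].
rewrite -(completionsE (leqnn n) _ p0 p0) // /completions -sum1_card.
have U0 D : D :&: above n = set0.
  by apply/setP => z; rewrite !inE leqNgt pos_lt andbF.
by apply: eq_bigr => p _; rewrite !U0 eqxx.
Qed.

End ExtensionsCount.

(** * Ranks in a finite linear order *)

Section Ranks.

Variables (n : nat) (r : rel 'I_n).
Hypotheses (r_total : total r) (r_anti : antisymmetric r) (r_trans : transitive r).

Definition rank (i : 'I_n) := \sum_(j < n) r j i.

Lemma rank_le i j : (rank i <= rank j) = r i j.
Proof.
have rxx x : r x x by have := r_total x x; rewrite orbb.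
have mono a b : r a b -> rank a <= rank b.
  by move=> rab; apply: leq_sum => c _; case: (boolP (r c a)) => // /r_trans/(_ rab)->.
apply/idP/idP => [le|]; last exact: mono.
have /orP[//|rji] := r_total i j; have [->|ne] := eqVneq i j; first exact: rxx.
suff : rank j < rank i by rewrite ltnNge le.
rewrite /rank (bigD1 i) //= [ltnRHS](bigD1 i) //= rxx.
have -> : r i j = false by apply/negP => rij; rewrite (@r_anti i j) ?eqxx // ?rij in ne.
rewrite add0n add1n ltnS; apply: leq_sum => c _.
by case: (boolP (r c j)) => // /r_trans/(_ rji)->.
Qed.

Lemma rank_inj : injective rank.
Proof. by move=> i j e; apply: r_anti; rewrite -!rank_le e leqnn. Qed.

Lemma rank_gt0 i : 0 < rank i.
Proof.
have rii : r i i by have := r_total i i; rewrite orbb.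
by rewrite /rank (bigD1 i) //= rii.
Qed.

Lemma rank_le_n i : rank i <= n.
Proof.
rewrite -[leqRHS]card_ord -sum1_card; apply: leq_sum => j _; exact: leq_b1.
Qed.

End Ranks.

(** * Linear orders from a transitive orientation *)

Section Conjugate.

Variables (n : nat) (le F : rel 'I_n).
Hypotheses (le_refl : reflexive le) (le_anti : antisymmetric le) (le_trans : transitive le).
Hypotheses (F_inc : forall i j, F i j || F j i = inc le i j) (F_asym : forall i j, F i j -> ~~
  F j i).
Hypothesis F_trans : transitive F.

Definition sum_rel : rel 'I_n := fun i j => le i j || F i j.

Lemma F_incomparable i j : F i j -> ~~ le i j /\ ~~ le j i.
Proof. by move=> Fij; have := F_inc i j; rewrite Fij => /esym/andP. Qed.

Lemma F_total i j : [|| le i j, le j i, F i j | F j i].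
Proof. by rewrite F_inc /inc; case: (le i j) (le j i) => [] []. Qed.

Lemma sum_rel_total : total sum_rel.
Proof.
move=> i j; have := F_total i j; rewrite /sum_rel.
by case/or4P => ->; rewrite ?orbT.
Qed.

Lemma sum_rel_anti : antisymmetric sum_rel.
Proof.
move=> i j /andP[/orP[lij|Fij] /orP[lji|Fji]].
- by apply: le_anti; rewrite lij.
- by have [_ /negP] := F_incomparable Fji.
- by have [_ /negP] := F_incomparable Fij.
- by have := F_asym Fij; rewrite Fji.
Qed.

(** In the mixed cases a relation from [k] back to [i] would compose with one of the given ones and
    make an incomparable pair comparable, or orient a comparable one. *)
Lemma sum_rel_trans : transitive sum_rel.
Proof.
move=> j i k; rewrite /sum_rel => /orP[lij|Fij] /orP[ljk|Fjk].
- by rewrite (le_trans lij ljk).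
- have [njk nkj] := F_incomparable Fjk; case/or4P: (F_total i k) => [->//|lki|->|Fki].
  + by rewrite (le_trans lki lij) in nkj.
  + by rewrite orbT.
  + by have [_ /negP] := F_incomparable (F_trans Fjk Fki).
- have [nij nji] := F_incomparable Fij; case/or4P: (F_total i k) => [->//|lki|->|Fki].
  + by rewrite (le_trans ljk lki) in nji.
  + by rewrite orbT.
  + by have [_ /negP] := F_incomparable (F_trans Fki Fij).
- by rewrite (F_trans Fij Fjk) orbT.
Qed.

Lemma rank_sum_rel i : \sum_(j < n) (le j i + F j i) = rank sum_rel i.
Proof.
apply: eq_bigr => j _; rewrite /sum_rel; case: (boolP (F j i)) => [/F_incomparable[/negPf->]//|_].
by rewrite addn0 orbF.
Qed.

End Conjugate.

(** * Correctness and running time of the program *)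

Definition diameter_cmd : cmd :=
  CSeq rows_cmd (CSeq orientation_cmd (CSeq positions_cmd count_cmd)).

Lemma diameter_cmd_correct (disp : Order.disp_t) (P : finPOrderType disp)
    (e : 'I_#|P| -> P) (s : store) :
  bijective e -> two_dimensional P ->
  var s 0 = #|P| -> (forall k i, arr s k i = 0) ->
  let inp := memory (poset_input e) in
  is_linext_diameter (downset P) (eval inp (EArr 3 (EV 11)) (run inp #|P| diameter_cmd s)).
Proof.
move=> [f ef fe] [L1 [L2 [[tot1 anti1 tr1 ext1] [tot2 anti2 tr2 ext2] real]]] s0 a0 inp.
pose n := #|P|; pose le : rel 'I_n := fun i j => (e i <= e j)%O.
have e_inj := can_inj ef.
have le_refl : reflexive le by move=> i; apply: Order.POrderTheory.le_refl.
have le_anti : antisymmetric le.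
  by move=> i j lij; apply: e_inj; apply: Order.POrderTheory.le_anti.
have le_tr : transitive le by move=> j i k; apply: Order.POrderTheory.le_trans.
have inpE (i j : 'I_n) : inp (i * n + j) = le i j.
  congr nat_of_bool; apply/existsP/idP => [[i' /existsP[j' /andP[/eqP c]]]|lij].
    by have [-> ->] : (i, j) = (i', j') by apply: code_inj.
  by exists i; apply/existsP; exists j; rewrite eqxx.
(* The machine does not see the realizer, which only provides an orientation for the lemmas on
   forcing. [R] is transitive since [L2] reverses [L1] on incomparable pairs. *)
pose R : rel 'I_n := fun i j => inc le i j && L1 (e i) (e j).
have R_inc i j : inc le i j = R i j || R j i.
  by rewrite /R (inc_sym le j i) -andb_orr tot1 andbT.
have L2R i j : R i j -> L2 (e j) (e i).
  move=> /andP[/andP[nij _] l1]; have /orP[//|l2] := tot2 (e j) (e i).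
  by move: nij; rewrite /le real l1 l2.
have R_tr : transitive R.
  move=> j i k Rij Rjk; have [l1 l2] : L1 (e i) (e k) /\ L2 (e k) (e i).
    split; last exact: tr2 (L2R _ _ Rjk) (L2R _ _ Rij).
    by case/andP: Rij => _ h; case/andP: Rjk => _; apply: tr1.
  have nik : e i != e k.
    apply/eqP => /e_inj eik; move: Rij Rjk => /andP[/andP[nij _] h1] /andP[_ h2].
    have eij : e i = e j by apply: anti1; rewrite h1 eik.
    by move/e_inj: eij nij => ->; rewrite le_refl.
  rewrite /R l1 andbT /inc /le !real l1 l2 /= andbT; apply/andP; split; apply/negP => h.
    by move/eqP: nik; apply; apply: anti2; rewrite h.
  by move/eqP: nik; apply; apply: anti1; rewrite l1.
pose F := lexico (inc le).
have Gs := inc_sym le; have Gi := inc_irr le_refl.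
have F_asym i j : F i j -> ~~ F j i := @lexico_asym _ _ Gs Gi _ R_tr R_inc i j.
have F_inc i j : F i j || F j i = inc le i j.
  apply/idP/idP; last exact: lexico_total.
  by case/orP => /lexico_edge //; rewrite Gs.
have F_tr : transitive F := lexico_trans Gs Gi R_tr R_inc.
pose F' : rel 'I_n := fun i j => F j i.
have F'_asym i j : F' i j -> ~~ F' j i by apply: F_asym.
have F'_inc i j : F' i j || F' j i = inc le i j by rewrite orbC F_inc.
have F'_tr : transitive F' by move=> j i k h1 h2; apply: F_tr h2 h1.
pose r1 := sum_rel le F; pose r2 := sum_rel le F'.
have [t1 t2] : total r1 /\ total r2 by split; apply: sum_rel_total.
have [an1 an2] : antisymmetric r1 /\ antisymmetric r2 by split; apply: sum_rel_anti.
have [tt1 tt2] : transitive r1 /\ transitive r2 by split; apply: sum_rel_trans.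
have rank1E i : rank1 le F i = rank r1 i by apply: rank_sum_rel.
have rank2E i : rank2 le F i = rank r2 i by apply: rank_sum_rel.
(* The dynamic program counts positions from 0, hence the predecessor; heights still start at 1, as
   0 stands for an empty set. *)
pose pos z := (rank r1 (f z)).-1; pose hgt z := rank r2 (f z).
have posS z : (pos z).+1 = rank r1 (f z) by rewrite prednK ?rank_gt0.
have pos_le x y : (pos x <= pos y) = r1 (f x) (f y) by rewrite -ltnS !posS rank_le.
have pos_inj : injective pos.
  by move=> x y exy; apply: (can_inj fe); apply: (rank_inj t1 an1 tt1); rewrite -!posS exy.
have pos_lt z : pos z < n by rewrite posS rank_le_n.
have pos_onto k : k < n -> exists z, pos z = k.
  move=> ltk; have g_inj : injective (fun z => Ordinal (pos_lt z)) by move=> x y [/pos_inj].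
  have : Ordinal ltk \in codom (fun z => Ordinal (pos_lt z)).
    by apply: inj_card_onto g_inj _ _; rewrite card_ord.
  by case/codomP => z [] ->; exists z.
have leE x y : (x <= y)%O = (pos x <= pos y) && (hgt x <= hgt y).
  rewrite pos_le rank_le // /r1 /r2 /sum_rel /F' /le !fe.
  case: (_ <= _)%O => //=; apply/esym/negP => /andP[/F_asym/negP].
  by [].
have left_tr : transitive (left_of pos).
  have lE x y : left_of pos x y = F (f x) (f y).
    rewrite /left_of ltnNge pos_le /r1 /sum_rel /le !fe.
    have := F_inc (f x) (f y); rewrite /inc /le !fe; have := @F_asym (f x) (f y).
    by case: (x <= y)%O (y <= x)%O (F _ _) (F _ _) => [] [] [] [] //= /(_ isT).
  by move=> y x z; rewrite !lE; apply: F_tr.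
rewrite /diameter_cmd 3!run_seq; set s1 := run _ _ rows_cmd s.
have [rs1 v12 v10] := rows_ok inp s0; rewrite -/s1 in rs1 v12 v10.
have fr1 := run_frame inp n rows_cmd s; rewrite -/s1 in fr1.
set s2 := run _ _ orientation_cmd s1.
have fr2 := run_frame inp n orientation_cmd s1; rewrite -/s2 in fr2.
have a11 i : arr s1 1 i = 0 by rewrite fr1.2 ?a0.
have [v20 rs2 os2] := orientation_ok inpE le_refl R_tr R_inc v10 rs1 a11.
rewrite -/s2 in v20 rs2 os2; set s3 := run _ _ positions_cmd s2.
have fr3 := run_frame inp n positions_cmd s2; rewrite -/s3 in fr3.
have r_inj : injective (rank1 le F).
  by move=> i j; rewrite !rank1E; apply: (rank_inj t1 an1 tt1).
have := positions_ok inpE rs2 os2 r_inj; rewrite -/s3 => hs3.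
have HE z : arr s3 2 (pos z).+1 = hgt z by rewrite posS -rank1E hs3 rank2E.
have Hle k : k < n -> arr s3 2 k.+1 <= n.
  by move=> /pos_onto[z <-]; rewrite HE rank_le_n.
rewrite (@count_ok n inp (fun k => arr s3 2 k.+1) Hle s3) //.
- rewrite -(card_separated_pairs pos_inj pos_lt pos_onto (hgt := hgt)) //; last first.
    by move=> z; apply: rank_gt0.
  exact: linext_diameter_downset.
- by move=> i le_i; rewrite fr3.2 // rs2.
- by rewrite fr3.1 // fr2.1.
- by move=> i; rewrite fr3.2 // fr2.2 // fr1.2.
- by move=> i; rewrite fr3.2 // fr2.2 // fr1.2.
Qed.

Theorem theorem6 :
  exists (p : program) (T : nat -> nat),
    bigO T (fun n => n ^ 5) /\
    forall (disp : Order.disp_t) (P : finPOrderType disp) (e : 'I_#|P| -> P),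
      bijective e -> two_dimensional P ->
      exists (t : nat) (s : state),
        [/\ exec p (poset_input e) t s, t <= T #|P|
          & is_linext_diameter (downset P) (output s)].
Proof.
(* The depth 5 comes from the two loops over the rounds and the three over the triples within a
   round. *)
have [p [T [TO pT]]] := @program_of diameter_cmd (EArr 3 (EV 11)) 5 isT isT isT isT.
exists p, T; split => // disp P e e_bij dimP; pose inp := memory (poset_input e).
have inp_out a : #|P| * #|P| <= a -> inp a = 0.
  move=> le_a; rewrite /inp /=; apply/eqP; rewrite eqb0;
    apply/existsP => -[i /existsP[j /andP[/eqP ea _]]].
  move: le_a; rewrite ea leqNgt; apply/negP/negPn.
  apply: (@leq_trans (i.+1 * #|P|)); last by rewrite leq_mul2r ltn_ord orbT.
  by rewrite mulSnr ltn_add2l.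
have [v [t [s [ex le_t v0 out]]]] := pT #|P| inp inp_out.
exists t, s; split => //; rewrite out.
by apply: diameter_cmd_correct => // k i.
Qed.
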